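(* The regularized MDP (R-MDP) framework and the distributional stochastic MDP (DS-MDP) framework are equivalent, and they strictly subsume the stochastic MDP (S-MDP) framework if $|\mathcal A|\ge 3$.
   Context: Setting. An MDP model is specified by a tuple $(\mathcal S,\mathcal A,q,\gamma)$ with $\mathcal S$ a finite set of states, $\mathcal A$ a finite set of actions, $q(s'|s,a)$ the transition probabilities, $\gamma\in[0,1)$ the discount factor, together with the extra data below; the reward function $r=(r(a|s))\in\mathbb R^{|\mathcal S|\times|\mathcal A|}$ is an input to the model. $\Delta^\pi$ is the set of policies $\pi$ with $\pi(a|s)\ge0$, $\sum_a\pi(a|s)=1$ for all $s$; $\pi_s=(\pi(a|s))_{a}$ lies in the simplex $\Delta(|\mathcal A|)$. Trajectories are $\tau=(s_0,a_0,s_1,a_1,\dots)$. R-MDP: specified by concave regularizers $\phi_s:\Delta(|\mathcal A|)\to\mathbb R$, $s\in\mathcal S$; $V(s)=\sup_{\pi^t\in\Delta^\pi,\,t\ge0}\mathbb E_{\tau}[\sum_{t\ge0}\gamma^t(r(a_t|s_t)+\phi_{s_t}(\pi^t_{s_t}))\mid s_0=s]$. An optimal policy is $\pi_s\in\mathrm{argmax}_{\pi_s\in\Delta(|\mathcal A|)}\{w_s^{T}\pi_s+\phi_s(\pi_s)\}$ with $w_{sa}=r(a|s)+\gamma\sum_{s'}q(s'|s,a)V(s')$. The framework is the set of all such models. S-MDP: the reward is $r(a|s)+\epsilon(a|s)$, where the random noise vectors $\epsilon_s=(\epsilon(a|s))_{a\in\mathcal A}$ follow given continuous distributions $d_s$,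 $s\in\mathcal S$, independent over states, drawn afresh at every time step. At time $t$ and state $s$ the agent observes $\epsilon_s$ and takes action $\psi^t(s|\epsilon_s)\in\mathcal A$ given by a decision rule; $V(s)=\sup_{\psi^0,\psi^1,\dots}\mathbb E[\sum_{t\ge0}\gamma^t(r(a_t|s_t)+\epsilon(a_t|s_t))\mid s_0=s]$. An optimal decision rule is $\psi(s|\epsilon_s)=\mathrm{argmax}_a\{w_{sa}+\epsilon(a|s)\}$, $w_{sa}=r(a|s)+\gamma\sum_{s'}q(s'|s,a)V(s')$, and the associated policy is $\pi(a|s)=\mathbb P_\epsilon(\psi(s|\epsilon_s)=a)$. The framework is the set of all such models. DS-MDP: as the S-MDP, except that the distribution of the noise is only known to belong to a nonempty ambiguity set $\Xi=\otimes_{s\in\mathcal S}\Xi_s$, $\Xi_s$ a set of (continuous) distributions for $\epsilon_s$, and the distributions $d^t\in\Xi$ are selected together with the decision rules: $V(s)=\sup_{d^t\in\Xi,\,t\ge0}\sup_{\psi^0,\psi^1,\dots}\mathbb E_{\epsilon^t\sim d^t,\,t\ge0}[\sum_{t\ge0}\gamma^t(r(a_t|s_t)+\epsilon(a_t|s_t))\mid s_0=s]$ (assumed finite). The optimal policy is $\pi(a|s)=\mathbb P_{\epsilon_s\sim d_s(w_s)}[a=\mathrm{argmax}_{a'}\{w_{sa'}+\epsilon(a'|s)\}]$ with $w_{sa}=r(a|s)+\gamma\sum_{s'}q(s'|s,a)V(s')$ for this DS-MDP value function $V$ and $w_s=(w_{sa})_{a\in\mathcal A}$, where $d_s(w_s)$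 is the distribution (or limit of a sequence of distributions in $\Xi_s$, if $\Xi_s$ is not compact) attaining $\varphi_s(w_s)=\sup_{d_s\in\Xi_s}\mathbb E_{\epsilon_s\sim d_s}[\max_a\{w_{sa}+\epsilon(a|s)\}]$; equivalently $\pi(a|s)=\partial\varphi_s(w_s)/\partial w_{sa}$. The framework is the set of all such models. Equivalence of models: two models $X,Y$ are equivalent, $X\equiv Y$, iff they have the same tuple $(\mathcal S,\mathcal A,q,\gamma)$ and there is a constant vector $\alpha\in\mathbb R^{|\mathcal S|\times|\mathcal A|}$ such that, for any reward functions $r^X,r^Y$ with $r^X-r^Y=\alpha$, model $X$ with rewards $r^X$ and model $Y$ with rewards $r^Y$ yield the same value function and a common stationary optimal policy $\{\pi^*(a|s)\}$. Equivalence of frameworks: frameworks (sets of models) $\mathcal X,\mathcal Y$ are equivalent iff for each $X\in\mathcal X$ there is $Y\in\mathcal Y$ with $X\equiv Y$, and vice versa. Strict subsumption: $\mathcal X$ strictly subsumes $\mathcal Y$ iff for each $Y\in\mathcal Y$ there is $X\in\mathcal X$ with $X\equiv Y$, but there is $X\in\mathcal X$ such that no $Y\in\mathcal Y$ satisfies $X\equiv Y$.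
   Formalization: Each concave regularizer is also required to make the argmax over the simplex nonempty for every w, and all noise terms in S-MDP and DS-MDP models are required to be integrable; ''continuous distribution'' is read as absolutely continuous. *)

(* Defs.v *)
From HB Require Import structures.
From mathcomp Require Import all_boot all_order all_algebra.
From mathcomp Require Import all_classical all_reals all_analysis.
Set Implicit Arguments.
Unset Strict Implicit.
Unset Printing Implicit Defensive.
Import Order.TTheory GRing.Theory Num.Theory.
Import numFieldNormedType.Exports.
Local Open Scope classical_set_scope.
Local Open Scope ring_scope.

(* The tuple (S, A, q, gamma); [trans s a s'] is q(s'|s,a). *)
Record mdp (R : realType) := MDP {
  state : finType;
  action : finType;
  trans : state -> action -> state -> R;
  discount : R;
  state_gt0 : (0 < #|state|)%N;
  action_gt0 : (0 < #|action|)%N;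
  trans_ge0 : forall s a s', 0 <= trans s a s';
  trans_sum1 : forall s a, \sum_(s' : state) trans s a s' = 1;
  discount_ge0 : 0 <= discount;
  discount_lt1 : discount < 1 }.

Section Common.
Context {R : realType} (M : mdp R).
Local Notation S := (state M).
Local Notation A := (action M).
Local Notation gamma := (discount M).

Definition reward := S -> A -> R.

Definition simplex : set (A -> R) :=
  [set p | (forall a, 0 <= p a) /\ \sum_(a : A) p a = 1].

Definition policies : set (S -> A -> R) :=
  [set pi | forall s, simplex (pi s)].

(* Law of s_t given s_0 = s0, for the time-inhomogeneous chain with
   transition probabilities [P t s s'] from s_t = s to s_{t+1} = s'. *)
Fixpoint state_law (P : nat -> S -> S -> R) (s0 : S) (t : nat) : S -> R :=
  if t is t'.+1 then fun s' => \sum_(s : S) state_law P s0 t' s * P t' s s'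
  else fun s => (s == s0)%:R.

(* sum_t gamma^t E[x_t | s_0 = s0], where [rho t s] is the conditional
   expectation of the reward x_t collected at time t given s_t = s. *)
Definition discounted_return (P : nat -> S -> S -> R) (rho : nat -> S -> R)
    (s0 : S) : \bar R :=
  (\sum_(0 <= t <oo)
     (gamma ^+ t * \sum_(s : S) state_law P s0 t s * rho t s)%R%:E)%E.

(* The w_{sa} attached to a reward function and a value function. *)
Definition qvalue (r : reward) (V : S -> \bar R) (s : S) (a : A) : R :=
  r s a + gamma * \sum_(s' : S) trans s a s' * fine (V s').

(* What the comparison of models refers to: the value function and the
   stationary optimal policies, as functions of the input reward. *)
Record model := Model {
  value : reward -> S -> \bar R;
  optimal_policy : reward -> set (S -> A -> R) }.

(* Two models over the same tuple (S, A, q, gamma). *)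
Definition model_equiv (X Y : model) : Prop :=
  exists alpha : S -> A -> R, forall rX rY : reward,
    (forall s a, rX s a - rY s a = alpha s a) ->
    (forall s, value X rX s = value Y rY s) /\
    (exists pi, optimal_policy X rX pi /\ optimal_policy Y rY pi).

Definition framework_equiv (F G : set model) : Prop :=
  (forall X, F X -> exists2 Y, G Y & model_equiv X Y) /\
  (forall Y, G Y -> exists2 X, F X & model_equiv X Y).

Definition strictly_subsumes (F G : set model) : Prop :=
  (forall Y, G Y -> exists2 X, F X & model_equiv X Y) /\
  (exists2 X, F X & ~ exists2 Y, G Y & model_equiv X Y).

End Common.

Section RegularizedMDP.
Context {R : realType} (M : mdp R).
Local Notation S := (state M).
Local Notation A := (action M).

Definition concave_on_simplex (phi : (A -> R) -> R) : Prop :=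
  forall (p p' : A -> R) (t : R), simplex p -> simplex p' -> 0 <= t <= 1 ->
    t * phi p + (1 - t) * phi p' <= phi (fun a => t * p a + (1 - t) * p' a).

Definition reg_argmax (phi : (A -> R) -> R) (w : A -> R) : set (A -> R) :=
  [set p | simplex p /\ forall p', simplex p' ->
     \sum_(a : A) w a * p' a + phi p' <= \sum_(a : A) w a * p a + phi p].

(* Only the restriction of [reg s] to the simplex is used. The last field says
   that the argmax defining the optimal policies is never empty: a concave
   function on the simplex may jump down at the boundary, in which case the
   supremum need not be attained. *)
Record rmdp := RMDP {
  reg : S -> (A -> R) -> R;
  reg_concave : forall s, concave_on_simplex (reg s);
  reg_argmax_neq0 : forall s (w : A -> R), reg_argmax (reg s) w !=set0 }.

Definition rmdp_return (phi : S -> (A -> R) -> R) (r : reward M)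
    (pi : nat -> S -> A -> R) : S -> \bar R :=
  discounted_return
    (fun t s s' => \sum_(a : A) pi t s a * trans s a s')
    (fun t s => \sum_(a : A) pi t s a * (r s a + phi s (pi t s))).

Definition rmdp_value (X : rmdp) (r : reward M) (s : S) : \bar R :=
  ereal_sup [set rmdp_return (reg X) r pi s
            | pi in [set pi : nat -> S -> A -> R | forall t, policies (pi t)]].

Definition rmdp_optimal (X : rmdp) (r : reward M) : set (S -> A -> R) :=
  [set pi | forall s, reg_argmax (reg X s) (qvalue r (rmdp_value X r) s) (pi s)].

Definition rmdp_model (X : rmdp) : model M :=
  Model (rmdp_value X) (rmdp_optimal X).

Definition RMDP_framework : set (model M) := range rmdp_model.

End RegularizedMDP.

(* Lebesgue measure of a Borel set of R^n, computed by integrating the measures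
   of its sections. *)
Fixpoint lebesgue_tuple {R : realType} (n : nat) : set (n.-tuple R) -> \bar R :=
  match n return set (n.-tuple R) -> \bar R with
  | 0 => fun B => (\1_B [tuple])%:E
  | n'.+1 => fun B => (\int[lebesgue_measure]_(x in [set: R])
      lebesgue_tuple [set u : n'.-tuple R | B [tuple of x :: u]])%E
  end.

Section StochasticMDP.
Context {R : realType} (M : mdp R).
Local Notation S := (state M).
Local Notation A := (action M).

(* A noise vector (eps(a|s))_{a in A}; actions are numbered by [enum_rank]. *)
Local Notation noise := (#|A|.-tuple R).

Definition noise_at (e : noise) (a : A) : R := tnth e (enum_rank a).

(* "Continuous" is absolutely continuous with respect to Lebesgue measure on
   R^A, so that ties in the argmax have probability 0; a finite mean is needed
   for the expected rewards to be defined. *)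
Definition continuous_noise (d : probability noise R) : Prop :=
  forall B : set noise, measurable B ->
    lebesgue_tuple B = 0%E -> d B = 0%E.

Definition integrable_noise (d : probability noise R) : Prop :=
  forall a : A, d.-integrable [set: noise] (fun e => (noise_at e a)%:E).

(* [psi s e] is the action taken in state s after observing the noise e. *)
Definition decision_rules : set (S -> noise -> A) :=
  [set psi | forall s a, measurable [set e : noise | psi s e = a]].

(* [d t s] is the law of the noise vector observed at time t in state s. The
   noise is redrawn at every step and only the vector of the current state is
   used, so the joint law over the states enters through its marginals only. *)
Definition noisy_return (d : nat -> S -> probability noise R) (r : reward M)
    (psi : nat -> S -> noise -> A) : S -> \bar R :=
  discounted_return
    (fun t s s' => \int[d t s]_e trans s (psi t s e) s')
    (fun t s => \int[d t s]_e (r s (psi t s e) + noise_at e (psi t s e))).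

Definition noisy_value (d : nat -> S -> probability noise R) (r : reward M)
    (s : S) : \bar R :=
  ereal_sup [set noisy_return d r psi s
            | psi in [set psi : nat -> S -> noise -> A
                     | forall t, decision_rules (psi t)]].

Definition noisy_argmax (w : A -> R) (e : noise) : set A :=
  [set a | forall a', w a' + noise_at e a' <= w a + noise_at e a].

Record smdp := SMDP {
  noise_law : S -> probability noise R;
  law_continuous : forall s, continuous_noise (noise_law s);
  law_integrable : forall s, integrable_noise (noise_law s) }.

Definition smdp_value (X : smdp) : reward M -> S -> \bar R :=
  noisy_value (fun=> noise_law X).

Definition smdp_optimal (X : smdp) (r : reward M) : set (S -> A -> R) :=
  [set pi | exists psi : S -> noise -> A,
     [/\ decision_rules psi,
         forall s e, noisy_argmax (qvalue r (smdp_value X r) s) e (psi s e) &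
         forall s a, (pi s a)%:E = noise_law X s [set e | psi s e = a]]].

Definition smdp_model (X : smdp) : model M :=
  Model (smdp_value X) (smdp_optimal X).

Definition SMDP_framework : set (model M) := range smdp_model.

Definition ds_value (Xi : S -> set (probability noise R)) (r : reward M)
    (s : S) : \bar R :=
  ereal_sup [set noisy_value d r s
            | d in [set d : nat -> S -> probability noise R
                   | forall t s', Xi s' (d t s')]].

Record dsmdp := DSMDP {
  ambiguity : S -> set (probability noise R);
  ambiguity_neq0 : forall s, ambiguity s !=set0;
  ambiguity_continuous : forall s d, ambiguity s d -> continuous_noise d;
  ambiguity_integrable : forall s d, ambiguity s d -> integrable_noise d;
  ds_value_fin : forall r s, ds_value ambiguity r s \is a fin_num }.

(* E_{eps ~ d}[max_a {w_a + eps_a}] *)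
Definition expected_max (w : A -> R) (d : probability noise R) : \bar R :=
  (\int[d]_e \big[maxe/-oo]_(a : A) (w a + noise_at e a)%R%:E)%E.

Definition surplus (D : set (probability noise R)) (w : A -> R) : \bar R :=
  ereal_sup [set expected_max w d | d in D].

(* The policies P_{eps ~ d_s(w_s)}[a = argmax], where d_s(w_s) attains the
   surplus, possibly as a limit of distributions of the ambiguity set. The limit
   is taken in the surplus and in the choice probabilities: a maximizing
   sequence need not be tight, so that it may have no limit as a distribution.
   A maximizer in the ambiguity set is covered by the constant sequence. *)
Definition dsmdp_optimal (X : dsmdp) (r : reward M) : set (S -> A -> R) :=
  [set pi | forall s,
     let w := qvalue r (ds_value (ambiguity X) r) s in
     exists d : nat -> probability noise R,
       [/\ forall n, ambiguity X s (d n),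
           expected_max w (d n) @[n --> \oo] --> surplus (ambiguity X s) w &
           forall a, d n [set e | noisy_argmax w e a] @[n --> \oo]
                     --> (pi s a)%:E]].

Definition dsmdp_model (X : dsmdp) : model M :=
  Model (ds_value (ambiguity X)) (dsmdp_optimal X).

Definition DSMDP_framework : set (model M) := range dsmdp_model.

End StochasticMDP.

Arguments RMDP_framework {R} M.
Arguments SMDP_framework {R} M.
Arguments DSMDP_framework {R} M.

(* Main.v *)
Require Import Defs.
From HB Require Import structures.
From mathcomp Require Import all_boot all_order all_algebra.
From mathcomp Require Import all_classical all_reals all_analysis.
From mathcomp Require Import measurable_realfun ring lra.

Set Implicit Arguments.
Unset Strict Implicit.
Unset Printing Implicit Defensive.
Import Order.TTheory GRing.Theory Num.Theory.
Import numFieldNormedType.Exports.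
Local Open Scope classical_set_scope.
Local Open Scope ring_scope.

(** Every framework lets the agent choose, at each time and in each state s, a
control: a probability vector p over the actions together with a bonus c, which
yields the expected reward r_s . p + c. A regularized model offers the pairs
(p, phi_s p); a model with noise offers the pairs made of the choice
probabilities and of the mean collected noise, for all admissible laws and all
decision rules. Both the dynamics and the rewards depend on the controls only
through these pairs, so each value function solves the Bellman equation
V s = F_s (r_s + gamma q V) ([control_value_fixpoint]), in which the control set
enters only through its support function F_s w = sup (w . p + c). Hence equal
support functions give equal values ([control_value_eq]), and conversely values
that agree for all rewards up to a shift force the support functions to agree up
to that shift ([control_value_inj]). The comparison of frameworks becomes a
comparison of convex functions F_s.

From noise to regularizers, phi_s is the concave conjugate
phi_s p = inf_w (F_s w - w . p). The limit of the choice probabilities along a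
maximizing sequence of laws is a subgradient of F_s that lies in the simplex
([maximizing_limit_subgradient]), and such limits exist by compactness
([maximizing_limit_exists]). A subgradient p at w attains
F_s w = w . p + phi_s p. So the conjugate recovers F_s, its argmax is never
empty, and every optimal policy of the noisy model is optimal for the
regularized one. Stochastic models are the case of singleton ambiguity sets.

From regularizers to noise, the ambiguity set consists of all absolutely
continuous integrable laws whose expected maximal utility is at most F_s everywhere. It has
to be rich enough to reach F_s. For an optimal p at w this is achieved by
[dominated_spiked_noise]: draw an action a with probability p a, put the noise
of a just below phi_s p, and push the noises of all other actions down by a large
amount L, so that a is chosen. The expected maximum at w is then almost
w . p + phi_s p = F_s w, and for L large enough it stays below F_s at every other
point.

The inclusion of stochastic models is strict because F_s w = max_a w_a, which
comes from the zero regularizer, has kinks. If E max_a (w_a - al_a + eps_a) were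
equal to max_a w_a, then moving from w = 0 to a basis vector would show that each
action is almost surely optimal at 0 ([kink_argmax]), whereas an absolutely
continuous noise leaves a unique optimal action almost surely. *)

(** * Support functions of control sets *)
Section Support.
Context {R : realType} {M : mdp R}.
Local Notation A := (action M).
Implicit Types (C : set ((A -> R) * R)) (w : A -> R) (u : (A -> R) * R).

(** A control is a pair of a choice vector over the actions and of the bonus it
earns on top of the rewards. *)
Definition payoff w u : R := \sum_a w a * u.1 a + u.2.

Definition feasible C : Prop :=
  [/\ C !=set0, forall u, C u -> simplex u.1 &
      exists K, forall u, C u -> u.2 <= K].

Definition support_fun C w : R := sup [set payoff w u | u in C].

Lemma simplex_point a : simplex (fun b : A => (b == a)%:R : R).
Proof.
split => [b|]; first exact: ler0n.
by rewrite (bigD1 a)//= eqxx big1 ?addr0// => b /negbTE ->.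
Qed.

Lemma point_mean w a : \sum_b w b * (b == a)%:R = w a.
Proof.
rewrite (bigD1 a)//= eqxx mulr1 big1 ?addr0// => b /negbTE ->.
by rewrite mulr0.
Qed.

Lemma le_sum_norm w a : w a <= \sum_b `|w b|.
Proof.
rewrite (bigD1 a)//= (le_trans (ler_norm _))// lerDl.
exact: sumr_ge0.
Qed.

Lemma simplex_mean_le (p x : A -> R) k : simplex p ->
  (forall a, 0 < p a -> x a <= k) -> \sum_a x a * p a <= k.
Proof.
move=> [p0 p1] xk; rewrite -[leRHS]mulr1 -p1 mulr_sumr.
apply: ler_sum => a _; have := p0 a; rewrite le_eqVlt => /predU1P[<-|pa].
  by rewrite !mulr0.
by rewrite ler_wpM2r// ?xk// ltW.
Qed.

Lemma simplex_mean_ge (p w : A -> R) : simplex p ->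
  - \sum_a `|w a| <= \sum_a w a * p a.
Proof.
move=> sp; rewrite lerNl -sumrN; under eq_bigr do rewrite -mulNr.
apply: simplex_mean_le => // a _.
by under eq_bigr do rewrite -normrN; exact: (le_sum_norm (fun b => - w b)).
Qed.

Lemma payoff_has_sup C w : feasible C -> has_sup [set payoff w u | u in C].
Proof.
move=> [[u0 Cu0] sC [K CK]]; split; first by exists (payoff w u0), u0.
exists (\sum_a `|w a| + K) => _ [u Cu <-].
rewrite lerD ?CK//; apply: simplex_mean_le; first exact: sC.
by move=> a _; exact: le_sum_norm.
Qed.

Lemma support_ge C w u : feasible C -> C u -> payoff w u <= support_fun C w.
Proof.
move=> fC Cu; apply: ub_le_sup; first by have [] := payoff_has_sup w fC.
by exists u.
Qed.

Lemma support_le C w k : feasible C -> (forall u, C u -> payoff w u <= k) ->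
  support_fun C w <= k.
Proof.
move=> [[u0 Cu0] _ _] Ck; apply: ge_sup; first by exists (payoff w u0), u0.
by move=> _ [u Cu <-]; exact: Ck.
Qed.

Lemma support_approx C w e : feasible C -> 0 < e ->
  exists2 u, C u & support_fun C w - e < payoff w u.
Proof.
move=> fC e0; have [_ [u Cu <-] ?] := sup_adherent e0 (payoff_has_sup w fC).
by exists u.
Qed.

Lemma payoff_le_shift w w' u k : simplex u.1 -> (forall a, w' a <= w a + k) ->
  payoff w' u <= payoff w u + k.
Proof.
move=> su ww'; rewrite /payoff addrAC lerD2r -lerBlDl -sumrB.
under eq_bigr do rewrite -mulrBl.
by apply: simplex_mean_le => // a _; rewrite lerBlDl.
Qed.

(** Monotonicity and translation in one statement: this is what makes the Bellman
operator a monotone contraction. *)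
Lemma support_le_shift C w w' k : feasible C -> (forall a, w' a <= w a + k) ->
  support_fun C w' <= support_fun C w + k.
Proof.
move=> fC ww'; apply: support_le => // u Cu; have [_ sC _] := fC.
by rewrite (le_trans (payoff_le_shift (sC _ Cu) ww'))// lerD2r support_ge.
Qed.

End Support.

(** * Values of controlled chains as Bellman fixed points *)
Section Control.
Context {R : realType} (M : mdp R).
Local Notation S := (state M).
Local Notation A := (action M).
Local Notation gamma := (discount M).
Local Notation control := ((A -> R) * R)%type.
Implicit Types (C : S -> set control) (r : reward M) (v : S -> R).

Definition control_return r (u : nat -> S -> control) : S -> \bar R :=
  discounted_return
    (fun t s s' => \sum_a (u t s).1 a * trans s a s')
    (fun t s => payoff (r s) (u t s)).

Definition control_value C r (s : S) : \bar R :=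
  ereal_sup [set control_return r u s
            | u in [set u : nat -> S -> control | forall t s', C s' (u t s')]].

(** [qvalue] for a finite value function. *)
Definition qreal r v : S -> A -> R := qvalue r (EFin \o v).

Lemma qrealE r v s a :
  qreal r v s a = r s a + gamma * \sum_s' trans s a s' * v s'.
Proof. by []. Qed.

Lemma payoff_qreal r v s u : payoff (qreal r v s) u =
  payoff (r s) u + gamma * \sum_s' (\sum_a u.1 a * trans s a s') * v s'.
Proof.
rewrite /payoff addrAC; congr (_ + _).
under eq_bigr do rewrite qrealE mulrDl.
rewrite big_split/=; congr (_ + _); under eq_bigr do rewrite -mulrA.
rewrite -mulr_sumr; congr (_ * _).
under eq_bigr do rewrite mulr_suml.
rewrite exchange_big/=; apply: eq_bigr => s' _; rewrite mulr_suml.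
by apply: eq_bigr => a _; ring.
Qed.

Section Return.
Variables (r : reward M) (u : nat -> S -> control) (s0 : S).
Hypothesis su : forall t s, simplex (u t s).1.
Let P t s s' := \sum_a (u t s).1 a * trans s a s'.
Let law := state_law P s0.

Lemma law_ge0 t s : 0 <= law t s.
Proof.
rewrite /law; elim: t s => [|t IH] s /=; first by rewrite ler0n.
apply: sumr_ge0 => s' _; rewrite mulr_ge0 ?IH//.
by apply: sumr_ge0 => a _; rewrite mulr_ge0 ?trans_ge0//; case: (su t s').
Qed.

Lemma law_sum1 t : \sum_s law t s = 1.
Proof.
rewrite /law; elim: t => [|t IH] /=.
  by rewrite (bigD1 s0)//= eqxx big1 ?addr0// => s /negbTE ->.
rewrite exchange_big/= -[RHS]IH; apply: eq_bigr => s _.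
rewrite -mulr_sumr exchange_big/=.
under eq_bigr do rewrite -mulr_sumr trans_sum1 mulr1.
by case: (su t s) => _ ->; rewrite mulr1.
Qed.

Lemma law_mean_norm t v : `|\sum_s law t s * v s| <= \sum_s `|v s|.
Proof.
rewrite (le_trans (ler_norm_sum _ _ _))//; apply: ler_sum => s _.
rewrite normrM ger0_norm ?law_ge0// ler_piMl//.
rewrite -(law_sum1 t) (bigD1 s)//= lerDl.
by apply: sumr_ge0 => s' _; exact: law_ge0.
Qed.

Let gain v t := gamma ^+ t *
  \sum_s law t s * (payoff (qreal r v s) (u t s) - v s).

(** Telescoping: for an arbitrary v, the reward collected up to time T plus the
discounted expected v at time T differs from v s0 by the accumulated one-step
Bellman errors. Both bounds on the return come from this identity. *)
Lemma partial_return v T :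
  \sum_(0 <= t < T) gamma ^+ t * \sum_s law t s * payoff (r s) (u t s) +
    gamma ^+ T * \sum_s law T s * v s =
  v s0 + \sum_(0 <= t < T) gain v t.
Proof.
elim: T => [|T IH].
  rewrite !big_geq// add0r addr0 expr0 mul1r /law /= (bigD1 s0)//= eqxx mul1r.
  by rewrite big1 ?addr0// => s /negbTE ->; rewrite mul0r.
rewrite big_nat_recr//= [in RHS]big_nat_recr//= addrA -IH -!addrA; congr (_ + _).
have -> : \sum_s law T.+1 s * v s =
    \sum_s law T s * \sum_s' P T s s' * v s'.
  rewrite /law /=; under eq_bigr do rewrite mulr_suml.
  rewrite exchange_big/=; apply: eq_bigr => s _; rewrite mulr_sumr.
  by apply: eq_bigr => s' _; rewrite mulrA.
rewrite /gain exprSr -!mulrA -mulrDr -mulrDr; congr (_ * _).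
rewrite mulr_sumr -!big_split/=; apply: eq_bigr => s _.
by rewrite payoff_qreal -/(P T s); ring.
Qed.

Section Supersolution.
Variable v : S -> R.
Hypothesis vsup : forall t s, payoff (qreal r v s) (u t s) <= v s.

Lemma gain_le0 t : gain v t <= 0.
Proof.
rewrite /gain mulr_ge0_le0 ?exprn_ge0 ?discount_ge0//.
apply: sumr_le0 => s _; rewrite mulr_ge0_le0 ?law_ge0//.
by rewrite subr_le0.
Qed.

(** The bonuses may be unbounded below, so that the series of rewards need not
converge absolutely. For a supersolution v the Bellman errors are nonpositive, so
their partial sums decrease and converge in the extended reals; the remaining
term is at most gamma^T times a constant. *)
Lemma control_return_cvg :
  (v s0 + \sum_(0 <= t < T) gain v t)%:E @[T --> \oo] -->
  control_return r u s0.
Proof.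
set z := (fun T => _).
have /ereal_nonincreasing_is_cvgn zc :
    {homo z : n m / (n <= m)%N >-> (m <= n)%E}.
  apply: homo_leq => [x//|y x t|n]; first by move=> ? /le_trans; apply.
  by rewrite /z lee_fin lerD2l big_nat_recr//= gerDl gain_le0.
suff -> : control_return r u s0 = lim (z @ \oo) by [].
apply/cvg_lim => //.
pose y T := gamma ^+ T * \sum_s law T s * v s.
have y0 : (y T)%:E @[T --> \oo] --> 0%:E.
  apply/cvg_EFin; first exact: nearW.
  have : (gamma ^+ T * \sum_s `|v s|) @[T --> \oo] --> 0.
    rewrite -[X in _ --> X](mul0r (\sum_s `|v s|)); apply: cvgMr_tmp.
    by apply: cvg_expr; rewrite ger0_norm ?discount_ge0 ?discount_lt1.
  move=> b0; apply: (@squeeze_cvgr _ _ _ _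
    (fun T => - (gamma ^+ T * \sum_s `|v s|))
    (fun T => gamma ^+ T * \sum_s `|v s|)).
  - apply: nearW => T; rewrite -ler_norml normrM.
    rewrite [X in X * _]ger0_norm ?exprn_ge0 ?discount_ge0//.
    by rewrite ler_wpM2l ?exprn_ge0 ?discount_ge0// law_mean_norm.
  - by rewrite -[X in _ --> X]oppr0; exact: (cvgN b0).
  - exact: b0.
rewrite -[X in _ --> X]sube0.
have -> : (fun n => \sum_(0 <= i < n | true) (gamma ^+ i *
   \sum_s state_law (fun t s s' => \sum_a (u t s).1 a * trans s a s') s0 i s *
         payoff (r s) (u i s))%:E)%E = (fun T => z T - (y T)%:E)%E.
  apply/funext => T; rewrite /z -partial_return sumEFin -EFinB.
  by congr EFin; rewrite /y addrK.
by apply: cvgeB => //; rewrite fin_num_adde_defl.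
Qed.

Lemma control_return_le : (control_return r u s0 <= (v s0)%:E)%E.
Proof.
rewrite -(cvg_lim _ control_return_cvg)//; apply: lime_le.
  by apply/cvg_ex; exists (control_return r u s0); exact: control_return_cvg.
apply: nearW => T; rewrite lee_fin gerDl.
by apply: sumr_le0 => t _; exact: gain_le0.
Qed.

Lemma control_return_ge e : 0 <= e ->
  (forall t s, v s - e * (1 - gamma) <= payoff (qreal r v s) (u t s)) ->
  ((v s0 - e)%:E <= control_return r u s0)%E.
Proof.
move=> e0 ve; rewrite -(cvg_lim _ control_return_cvg)//; apply: lime_ge.
  by apply/cvg_ex; exists (control_return r u s0); exact: control_return_cvg.
apply: nearW => T; rewrite lee_fin lerD2l.
have gT : forall t, - (gamma ^+ t * (e * (1 - gamma))) <= gain v t.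
  move=> t; rewrite /gain -mulrN ler_wpM2l ?exprn_ge0 ?discount_ge0//.
  rewrite -[leLHS]mul1r -{1}(law_sum1 t) mulr_suml; apply: ler_sum => s _.
  by rewrite ler_wpM2l ?law_ge0// lerBrDl; exact: ve.
apply: (@le_trans _ _ (\sum_(0 <= t < T) - (gamma ^+ t * (e * (1 - gamma))))).
  rewrite sumrN lerN2 -mulr_suml mulrCA ler_piMr//.
  suff -> : (\sum_(0 <= i < T) gamma ^+ i) * (1 - gamma) = 1 - gamma ^+ T.
    by rewrite gerBl exprn_ge0 ?discount_ge0.
  elim: T => [|T IH]; first by rewrite big_geq// mul0r expr0 subrr.
  by rewrite big_nat_recr//= mulrDl IH exprSr; ring.
by apply: ler_sum => t _; exact: gT.
Qed.

End Supersolution.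
End Return.

(** Any control sequence returns at most v, and the stationary choice of controls
that are optimal up to e (1 - gamma) in each state returns at least v - e. In
particular the fixed point is unique. *)
Lemma control_value_fixpoint C r v : (forall s, feasible (C s)) ->
  (forall s, v s = support_fun (C s) (qreal r v s)) ->
  forall s, control_value C r s = (v s)%:E.
Proof.
move=> fC vfix s0; apply/eqP; rewrite eq_le; apply/andP; split.
  apply: ge_ereal_sup => _ [u uC <-]; apply: control_return_le => t s.
    by have [_ sC _] := fC s; exact: sC.
  by rewrite [leRHS]vfix support_ge.
apply/lee_addgt0Pr => e e0.
have eg : 0 < e * (1 - gamma) by rewrite mulr_gt0// subr_gt0 discount_lt1.
have /choice[u uP] : forall s, exists u, C s u /\
    v s - e * (1 - gamma) < payoff (qreal r v s) u.
  move=> s; have [u Cu] := support_approx (qreal r v s) (fC s) eg.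
  by rewrite -vfix; exists u.
rewrite -leeBlDr//; apply: (@le_trans _ _ (control_return r (fun=> u) s0)).
  apply: control_return_ge => [t s|t s||t s]; last 2 first.
  - exact: ltW.
  - by have [_ /ltW] := uP s.
  - by have [_ sC _] := fC s; apply: sC; case: (uP s).
  - by rewrite [leRHS]vfix support_ge//; case: (uP s).
by apply: ereal_sup_ubound; exists (fun=> u) => // t s; case: (uP s).
Qed.

(** The pointwise supremum of all subsolutions, as in the Knaster-Tarski theorem.
Discounting bounds the subsolutions above and provides a constant one. *)
Lemma bellman_fixpoint C r : (forall s, feasible (C s)) ->
  exists v, forall s, v s = support_fun (C s) (qreal r v s).
Proof.
move=> fC; pose T v s := support_fun (C s) (qreal r v s).
have g0 := discount_ge0 M.
have g1 : 0 < 1 - gamma by rewrite subr_gt0 discount_lt1.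
have Tle v v' k : (forall s, v' s <= v s + k) ->
    forall s, T v' s <= T v s + gamma * k.
  move=> vv' s; apply: support_le_shift => // a.
  rewrite !qrealE -addrA lerD2l -mulrDr ler_wpM2l//.
  rewrite -lerBlDl -sumrB.
  under eq_bigr do rewrite -mulrBr.
  rewrite -[leRHS]mul1r -(trans_sum1 s a) mulr_suml; apply: ler_sum => s' _.
  by rewrite ler_wpM2l ?trans_ge0// lerBlDl.
have Tmono v v' : (forall s, v' s <= v s) -> forall s, T v' s <= T v s.
  move=> vv' s; rewrite -[leRHS]addr0 -(mulr0 gamma).
  by apply: Tle => s'; rewrite addr0.
(* A constant that the Bellman operator cannot raise, and whose opposite it
   cannot lower. *)
pose B := \sum_s `|T (fun=> 0) s| / (1 - gamma).
have B0 s : `|T (fun=> 0) s| <= B * (1 - gamma).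
  rewrite /B -mulr_suml divfK ?gt_eqF// (bigD1 s)//= lerDl.
  exact: sumr_ge0.
pose sub := [set v | forall s, v s <= T v s].
have subB v : sub v -> forall s, v s <= B.
  move=> subv s; pose sm := [arg max_(s' > s) v s']%O.
  have vm s' : v s' <= v sm by rewrite /sm; case: arg_maxP => // m _; apply.
  apply: (le_trans (vm s)).
  have := Tle (fun=> 0) v (v sm) _ sm; move=> /(_ _)/[!add0r]/(_ vm).
  move=> /(le_trans (subv sm)); rewrite -lerBlDr.
  rewrite -{1}[v sm]mul1r -mulrBl mulrC => h.
  rewrite -(ler_pM2r g1) (le_trans h)//.
  by rewrite (le_trans _ (B0 sm))// ler_norm.
have subN : sub (fun=> - B).
  move=> s; have := Tle (fun=> - B) (fun=> 0) B _ s.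
  move=> /(_ _)/[!addNr]/(_ (fun=> lexx _)); rewrite -lerBlDr; apply: le_trans.
  rewrite lerBrDr.
  have := B0 s; rewrite ler_norml => /andP[+ _]; apply: le_trans.
  by rewrite mulrBr mulr1 opprB addrC mulrC.
pose vs s := sup [set v s | v in sub].
have hs s : has_sup [set v s | v in sub].
  split; first by exists (- B), (fun=> - B).
  by exists B => _ [v sv <-]; exact: subB.
have vs_ub v s : sub v -> v s <= vs s.
  by move=> sv; apply: ub_le_sup; [case: (hs s)|exists v].
have vs_sub : sub vs.
  move=> s; apply: ge_sup; first by case: (hs s).
  move=> _ [v sv <-]; apply: (le_trans (sv s)); apply: Tmono => s'.
  exact: vs_ub.
exists vs => s; apply/eqP; rewrite eq_le vs_sub/=.
by apply: (@vs_ub (T vs)) => s'; exact: Tmono.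
Qed.

Lemma control_value_eq C C' : (forall s, feasible (C s)) ->
  (forall s, feasible (C' s)) ->
  (forall s, support_fun (C s) = support_fun (C' s)) ->
  forall r s, control_value C r s = control_value C' r s.
Proof.
move=> fC fC' CC' r s; have [v vfix] := bellman_fixpoint r fC.
rewrite (control_value_fixpoint fC vfix); apply/esym.
by apply: control_value_fixpoint => // s'; rewrite -CC'.
Qed.

(** Every w is the vector of action values, in all states at once, of a suitable
reward: take v = F w as the value function and r = w - gamma q v. So the values
for all rewards determine the support functions. *)
Lemma control_value_inj C C' (alpha : S -> A -> R) :
  (forall s, feasible (C s)) -> (forall s, feasible (C' s)) ->
  (forall r r', (forall s a, r s a - r' s a = alpha s a) ->
     forall s, control_value C r s = control_value C' r' s) ->
  forall s w, support_fun (C s) w = support_fun (C' s) (fun a => w a - alpha s a).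
Proof.
move=> fC fC' CC' s w.
pose v s' := support_fun (C s') w.
pose r s' a := w a - gamma * \sum_s'' trans s' a s'' * v s''.
have qv s' : qreal r v s' = w by apply/funext => a; rewrite qrealE /r subrK.
have vfix s' : v s' = support_fun (C s') (qreal r v s') by rewrite qv.
pose r' s' a := r s' a - alpha s' a.
have [v' v'fix] := bellman_fixpoint r' fC'.
have vv' : v' = v.
  apply/funext => s'; apply: EFin_inj.
  rewrite -(control_value_fixpoint fC' v'fix) -(control_value_fixpoint fC vfix).
  by apply/esym/CC' => ? ?; rewrite /r' subKr.
have := v'fix s; rewrite vv' -[support_fun (C s) w]/(v s) => ->.
congr (support_fun _ _); apply/funext => a.
by rewrite qrealE /r' /r; ring.
Qed.

Lemma control_value_mono C C' r s : (forall s, C s `<=` C' s) ->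
  (control_value C r s <= control_value C' r s)%E.
Proof.
move=> CC'; apply: ereal_sup_le => _ [u uC <-]; exists u => // t s'.
exact: CC'.
Qed.

(** Finiteness of the value bounds the bonuses: a control u can be used once, at
the state s0, alongside fixed controls elsewhere. The value v' of this small
family is finite and at most the value of C, while its Bellman equation gives
v' s0 >= u.2 up to a constant that does not depend on u, since v' is at least
the value v0 of the fixed controls alone. *)
Lemma control_value_feasible C : (forall s, C s !=set0) ->
  (forall s u, C s u -> simplex u.1) ->
  (forall s, control_value C (fun _ _ => 0%R) s < +oo)%E ->
  forall s, feasible (C s).
Proof.
move=> C0 sC Cfin s0; split; [exact: C0|exact: sC|].
have /choice[u0 Cu0] : forall s, exists u, C s u by exact: C0.
pose r0 : reward M := fun _ _ => 0.
have f0 s : feasible [set u0 s].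
  split; first by exists (u0 s).
  - by move=> _ ->; exact: sC.
  - by exists (u0 s).2 => _ ->.
have [v0 v0fix] := bellman_fixpoint r0 f0.
have v0val := control_value_fixpoint f0 v0fix.
exists (fine (control_value C r0 s0) + \sum_a `|qreal r0 v0 s0 a|) => u Cu.
pose C' s := [set x | x = u0 s \/ (s = s0 /\ x = u)].
have C'C s : C' s `<=` C s by move=> _ [->|[-> ->]].
have f' s : feasible (C' s).
  split; first by exists (u0 s); left.
  - by move=> x /C'C; exact: sC.
  - exists (Num.max (u0 s).2 u.2) => _ [->|[_ ->]]; rewrite le_max lexx ?orbT//.
have [v' v'fix] := bellman_fixpoint r0 f'.
have v'val := control_value_fixpoint f' v'fix.
have v0v' s : v0 s <= v' s.
  rewrite -lee_fin -v0val -v'val; apply: control_value_mono => s' _ ->.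
  by left.
have v'V : v' s0 <= fine (control_value C r0 s0).
  have V : ((v' s0)%:E <= control_value C r0 s0)%E.
    by rewrite -v'val; apply: control_value_mono.
  rewrite -lee_fin fineK// fin_real// (lt_le_trans _ V) ?ltNyr//.
  exact: Cfin.
rewrite -lerBlDr; apply: le_trans v'V.
have /(support_ge (qreal r0 v' s0) (f' s0)) : C' s0 u by right.
rewrite -v'fix; apply: le_trans; rewrite /payoff lerBlDr addrAC lerDr -lerBlDr sub0r.
apply: (le_trans (simplex_mean_ge (qreal r0 v0 s0) (sC _ _ Cu))).
have [u1 _] := sC _ _ Cu; apply: ler_sum => a _.
rewrite ler_wpM2r ?u1// !qrealE lerD2l ler_wpM2l ?discount_ge0//.
by apply: ler_sum => s _; rewrite ler_wpM2l ?trans_ge0.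
Qed.

Lemma eq_reward (r r' : reward M) :
  (forall s a, r s a - r' s a = 0) -> r = r'.
Proof.
move=> rr'; apply/funext => s; apply/funext => a; apply/eqP.
by rewrite -subr_eq0 rr'.
Qed.

End Control.

(** * Null sets and uniform laws on R^n *)
Section LebesgueTuple.
Context {R : realType}.

Lemma lebesgue_tuple0 n : lebesgue_tuple (set0 : set (n.-tuple R)) = 0%E.
Proof.
elim: n => [|n IH] /=; first by rewrite indicE in_set0.
by apply: integral0_eq => x _.
Qed.

Lemma integral_off_point (f : R -> \bar R) y :
  (forall x, x != y -> f x = 0%E) ->
  (\int[lebesgue_measure]_(x in [set: R]) f x = 0)%E.
Proof.
move=> fy.
rewrite (_ : f = f \_ [set y]); last first.
  apply/funext => x; rewrite patchE; case: ifPn => //.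
  by rewrite notin_setE/= => /eqP /fy.
by rewrite -integral_mkcond integral_set1.
Qed.

Lemma lebesgue_tuple_coord n (k : 'I_n) (y : R) :
  lebesgue_tuple [set u : n.-tuple R | tnth u k = y] = 0%E.
Proof.
elim: n k => [[]//|n IH] k /=.
case: (unliftP ord0 k) => [j ->|->].
  apply: integral0_eq => x _.
  by under eq_set do rewrite tnthS; exact: IH.
apply: (integral_off_point (y := y)) => x /eqP xy.
rewrite [X in lebesgue_tuple X](_ : _ = set0) ?lebesgue_tuple0//.
by apply/seteqP; split => // u /=; rewrite tnth0.
Qed.

Lemma lebesgue_tuple_tie n (i j : 'I_n) (c : R) : i != j ->
  lebesgue_tuple [set u : n.-tuple R | tnth u i = tnth u j + c] = 0%E.
Proof.
elim: n i j => [[]//|n IH] i j /=.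
case: (unliftP ord0 i) => [i' ->|->]; case: (unliftP ord0 j) => [j' ->|->] ij.
- apply: integral0_eq => x _; under eq_set do rewrite !tnthS.
  by apply: IH; apply: contra_neq ij => ->.
- apply: integral0_eq => x _; under eq_set do rewrite tnthS tnth0.
  exact: lebesgue_tuple_coord.
- apply: integral0_eq => x _.
  rewrite -[RHS](lebesgue_tuple_coord j' (x - c)); congr lebesgue_tuple.
  apply/seteqP; split => u /=; rewrite tnthS tnth0 => ->.
    by rewrite addrK.
  by rewrite subrK.
- by rewrite eqxx in ij.
Qed.

(** The integral of a nonnegative function is a supremum over the simple functions
below it, hence monotone even when the functions are not measurable. This
dispenses with proving that sections of a Borel set have measurable Lebesgue
measure. *)
Lemma ge0_integral_mono d (T : measurableType d)
    (mu : {measure set T -> \bar R}) (f g : T -> \bar R) :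
  (forall x, 0 <= f x)%E -> (forall x, f x <= g x)%E ->
  (\int[mu]_x f x <= \int[mu]_x g x)%E.
Proof.
move=> f0 fg; have g0 x : (0 <= g x)%E := le_trans (f0 x) (fg x).
rewrite !ge0_integralTE//; apply: ereal_sup_le => _ [h hf <-].
by exists h => // x; exact: le_trans (hf x) (fg x).
Qed.

Definition box n (l : nat -> R) (dl : R) : set (n.-tuple R) :=
  [set u | forall i : 'I_n, l i - dl <= tnth u i <= l i].

Lemma measurable_box n (l : nat -> R) (dl : R) :
  measurable (box (n := n) l dl).
Proof.
rewrite (_ : box l dl = \bigcap_(i in [set: 'I_n])
    ((tnth (T := R))^~ i @^-1` `[l i - dl, l i]%classic)).
  apply: fin_bigcap_measurable => [|i _]; first exact: finite_finset.
  by rewrite -[X in measurable X]setTI; exact: measurable_tnth.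
apply/seteqP; split => u /= ul i.
  by move=> _; rewrite /preimage/= in_itv/=; exact: ul.
by have := ul i Logic.I; rewrite /preimage/= in_itv.
Qed.

(** Product of n uniform laws. Absolute continuity is carried through the
induction as a bound P <= K * lebesgue_tuple: unlike the implication between null
sets, the bound can be integrated over the sections without knowing that their
Lebesgue measure is a measurable function. *)
Lemma uniform_box n (l : nat -> R) (dl : R) : 0 < dl ->
  exists P : probability (n.-tuple R) R,
    P (box (n := n) l dl) = 1%E /\
    exists2 K : R, 0 < K & forall B, measurable B ->
      (P B <= K%:E * lebesgue_tuple B)%E.
Proof.
move=> dl0; elim: n l => [|n IH] l.
  exists (dirac [tuple]); split.
    by rewrite /= diracE mem_set// => -[].
  by exists 1 => // B mB; rewrite mul1e /= diracE indicE.
have [P [Pbox [K K0 PK]]] := IH (fun i => l i.+1).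
have lt0 : l 0%N - dl < l 0%N by rewrite gtrBl.
pose U := uniform_prob lt0.
pose c (x : measurableTypeR R * n.-tuple R) : n.+1.-tuple R :=
  [tuple of (x.1 : R) :: x.2].
have mc : measurable_fun [set: measurableTypeR R * n.-tuple R] c.
  apply: measurable_cons => [mD Y mY|]; last exact: measurable_snd.
  exact: (measurable_fst mD (Y : set (measurableTypeR R)) mY).
pose cm : {mfun (measurableTypeR R * n.-tuple R)%type >-> n.+1.-tuple R} :=
  HB.pack c (isMeasurableFun.Build _ _ _ _ c mc).
pose Q := (U \x P)%E : probability _ R.
have QE B : Q (c @^-1` B) =
    (\int[U]_x P [set u : n.-tuple R | B [tuple of x :: u]])%E.
  rewrite /Q /= /product_measure1; apply: eq_integral => x _ /=.
  by congr (P _); apply/seteqP; split => u /=; rewrite /xsection/= inE.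
exists (distribution Q cm); split.
  have cbox : c @^-1` box (n := n.+1) l dl =
      `[l 0%N - dl, l 0%N] `*` box (n := n) (fun i => l i.+1) dl.
    apply/seteqP; split => -[x u] /=.
      move=> xu; split => /=.
        by have := xu ord0; rewrite tnth0 in_itv.
      by move=> i; have := xu (lift ord0 i); rewrite tnthS.
    rewrite in_itv/= => -[xl ul] i.
    by case: (unliftP ord0 i) => [j ->|->]; rewrite ?tnth0// tnthS; exact: ul.
  rewrite /distribution/= /pushforward/= cbox /Q/= product_measure1E//.
    by rewrite [X in (_ * X)%E]Pbox mule1 /= /uniform_prob integral_uniform_pdf1.
  exact: measurable_box.
exists (dl^-1 * K); first by rewrite mulr_gt0// invr_gt0.
move=> B mB; rewrite /distribution/= /pushforward/= QE.
pose g (x : measurableTypeR R) : \bar R := P [set u : n.-tuple R | B [tuple of x :: u]].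
have mcB : measurable (c @^-1` B).
  by rewrite -[X in measurable X]setTI; exact: (mc measurableT).
have mg : measurable_fun [set: measurableTypeR R] g.
  rewrite (_ : g = P \o xsection (c @^-1` B)); first exact: measurable_fun_xsection.
  apply/funext => x; congr (P _); apply/seteqP.
  by split => u /=; rewrite /xsection/= inE.
have mBx x : measurable [set u : n.-tuple R | B [tuple of x :: u]].
  have := measurable_xsection x mcB; congr measurable; apply/seteqP.
  by split => u /=; rewrite /xsection/= inE.
change (\int[U]_x g x <= (dl^-1 * K)%:E * lebesgue_tuple B)%E.
rewrite integral_uniform//.
rewrite opprB addrC subrK EFinM -muleA lee_pmul2l ?lte_fin ?invr_gt0//.
apply: (@le_trans _ _ (\int[lebesgue_measure]_x g x)%E).
  apply: ge0_subset_integral => //= x _; exact: measure_ge0.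
rewrite -[leRHS]/(K%:E * \int[lebesgue_measure]_(x in [set: R])
  lebesgue_tuple [set u : n.-tuple R | B [tuple of x :: u]])%E.
rewrite muleC -lee_pdivrMr//.
rewrite muleC -ge0_integralZl//; last by rewrite lee_fin invr_ge0 ltW.
apply: ge0_integral_mono => x.
  by rewrite mule_ge0// lee_fin invr_ge0 ltW.
by rewrite muleC lee_pdivrMr// muleC; exact: PK.
Qed.

End LebesgueTuple.

(** * Integrals along finite selections and finite covers *)
Section FiniteIntegrals.
Context {d : measure_display} {T : measurableType d} {R : realType}.
Context {I : finType}.
Implicit Types (P : probability T R).

Lemma measurable_le_set (f g : T -> R) : measurable_fun setT f ->
  measurable_fun setT g -> measurable [set x | f x <= g x].
Proof.
move=> mf mg; have := measurable_fun_ler mf mg measurableT (Y := [set true]).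
by rewrite setTI; apply.
Qed.

(** The selected index depends on x only through the finite vector of truth values
F i x, so each of its fibres is a finite union of Boolean combinations of the
sets F i. *)
Lemma measurable_selection (i0 : I) (F : I -> set T) :
  (forall i, measurable (F i)) -> (forall x, exists i, F i x) ->
  exists psi : T -> I, (forall i, measurable [set x | psi x = i]) /\
    forall x, F (psi x) x.
Proof.
move=> mF exF; pose g x : {ffun I -> bool} := [ffun i => `[<F i x>]].
pose sel (v : {ffun I -> bool}) := odflt i0 [pick i | v i].
exists (fun x => sel (g x)); split => [i|x]; last first.
  rewrite /sel; case: pickP => [j|h]; first by rewrite ffunE => /asboolP.
  by have [j Fj] := exF x; have := h j; rewrite ffunE => /asboolP.
have mg v : measurable [set x | g x = v].
  rewrite (_ : [set x | _] = \bigcap_(j in [set: I])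
      (if v j then F j else ~` F j)).
    apply: fin_bigcap_measurable => [|j _]; first exact: finite_finset.
    by case: ifP => _ //; exact: measurableC.
  apply/seteqP; split => x /=.
    move=> <- j _; rewrite ffunE; case: ifP => [/asboolP //|/negbT/asboolPn//].
  move=> Fx; apply/ffunP => j; rewrite ffunE; have := Fx j Logic.I.
  by case: (v j) => h; [apply/asboolP|apply/negbTE/asboolPn].
rewrite (_ : [set x | _] = \bigcup_(v in [set v | sel v = i]) [set x | g x = v]).
  by apply: fin_bigcup_measurable => //; exact: finite_finset.
by apply/seteqP; split => x /= => [<-|[v /= <- <-]//]; exists (g x).
Qed.

Lemma indic_select (psi : T -> I) (h : I -> T -> R) x :
  h (psi x) x = \sum_i \1_[set y | psi y = i] x * h i x.
Proof.
rewrite (bigD1 (psi x))//= indicE mem_set// mul1r big1 ?addr0// => i ix.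
by rewrite indicE memNset ?mul0r//= => xi; rewrite xi eqxx in ix.
Qed.

Lemma bounded_indic (A : set T) : [bounded (\1_A x : R) | x in setT].
Proof.
exists 1; split; first exact: num_real.
move=> y y1 x _; rewrite /= indicE (le_trans _ (ltW y1))//.
by case: (_ \in _); rewrite ?normr1 ?normr0.
Qed.

Lemma integrable_indicM P (A : set T) (h : T -> R) : measurable A ->
  P.-integrable setT (EFin \o h) ->
  P.-integrable setT (EFin \o (fun x => \1_A x * h x)).
Proof.
move=> mA ih; have m1 : measurable_fun setT (\1_A : T -> R).
  exact: measurable_indic.
by have := integrableMr measurableT m1 (bounded_indic A) ih; apply: eq_integrable.
Qed.

Lemma integrable_select P (psi : T -> I) (h : I -> T -> R) :
  (forall i, measurable [set x | psi x = i]) ->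
  (forall i, P.-integrable setT (EFin \o h i)) ->
  P.-integrable setT (EFin \o (fun x => h (psi x) x)).
Proof.
move=> mpsi ih.
have : P.-integrable setT (fun x =>
    \sum_i (\1_[set y | psi y = i] x * h i x)%:E)%E.
  apply: (integrable_sum measurableT) => i _; exact: integrable_indicM.
apply: eq_integrable => // x _.
by rewrite sumEFin -(indic_select psi h).
Qed.

Lemma Rintegral_select_cst P (psi : T -> I) (h : I -> R) :
  (forall i, measurable [set x | psi x = i]) ->
  \int[P]_x h (psi x) = \sum_i h i * fine (P [set x | psi x = i]).
Proof.
move=> mpsi; rewrite /Rintegral.
have -> : (\int[P]_x (h (psi x))%:E =
    \sum_i (h i)%:E * P [set x | psi x = i])%E.
  under eq_integral => x _.
    rewrite (indic_select psi (fun i _ => h i)) -sumEFin.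
    under eq_bigr do rewrite mulrC EFinM.
    over.
  rewrite integral_sum//=.
    apply: eq_bigr => i _; rewrite integralZl//.
      by rewrite integral_indic// setIT.
    exact: integrable_indic.
  by move=> i; apply: integrableZl => //; exact: integrable_indic.
rewrite -sum_fine => [|i _]; last first.
  by rewrite fin_numM// fin_num_measure.
by apply: eq_bigr => i _; rewrite fineM// fin_num_measure.
Qed.

Lemma probability_finite_cover P (B : I -> set T) (p : I -> R) :
  (forall i, measurable (B i)) -> trivIset setT B ->
  (forall i, P (B i) = (p i)%:E) -> \sum_i p i = 1 ->
  P (~` \bigcup_(i in [set: I]) B i) = 0%E.
Proof.
move=> mB tB PB p1; rewrite probability_setC; last first.
  by apply: fin_bigcup_measurable => // ; exact: finite_finset.
rewrite measure_fin_bigcup//; last exact: finite_finset.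
rewrite (fsbigE (enum I)) ?enum_uniq//; last by move=> i _; rewrite mem_enum.
rewrite big_enum_cond/= (eq_bigl xpredT) => [|i]; last exact: mem_set.
under eq_bigr do rewrite PB.
by rewrite sumEFin p1 subee.
Qed.

Lemma integrable_on_full P (U : set T) (f : T -> R) K : measurable U ->
  P (~` U) = 0%E -> measurable_fun setT f -> (forall x, U x -> `|f x| <= K) ->
  P.-integrable setT (EFin \o f).
Proof.
move=> mU PU mf fK.
apply/(negligible_integrable (measurableC mU) measurableT _ PU).
  exact/measurable_EFinP.
rewrite setTD setCK; apply: measurable_bounded_integrable => //.
- by rewrite (le_lt_trans (probability_le1 P mU))// ltry.
- exact: measurable_funTS.
- exists K; split; first exact: num_real.
  by move=> y Ky x Ux; rewrite /= (le_trans (fK _ Ux))// ltW.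
Qed.

(** Up to a null set the sets B i cover the space, so f is almost surely at most the
step function with value x i on B i. *)
Lemma Rintegral_le_cover P (B : I -> set T) (p x : I -> R) (f : T -> R) :
  (forall i, measurable (B i)) -> trivIset setT B ->
  (forall i, P (B i) = (p i)%:E) -> \sum_i p i = 1 ->
  P.-integrable setT (EFin \o f) ->
  (forall i y, B i y -> f y <= x i) ->
  \int[P]_y f y <= \sum_i x i * p i.
Proof.
move=> mB tB PB p1 intf fx; set U := \bigcup_(i in [set: I]) B i.
have mU : measurable U.
  by apply: fin_bigcup_measurable => //; exact: finite_finset.
have PU : P (~` U) = 0%E by exact: probability_finite_cover p1.
pose g y := \sum_i \1_(B i) y * x i.
have intg : P.-integrable setT (EFin \o g).
  have : P.-integrable setT (fun y => \sum_i (\1_(B i) y * x i)%:E)%E.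
    apply: (integrable_sum measurableT) => i _.
    by apply: integrable_indicM => //; exact: finite_measure_integrable_cst.
  by apply: eq_integrable => // y _; rewrite sumEFin.
have -> : \sum_i x i * p i = \int[P]_y g y.
  rewrite /Rintegral/=; under [in RHS]eq_integral do rewrite /g -sumEFin.
  rewrite integral_sum//=; last first.
    move=> i; apply: integrable_indicM => //.
    exact: finite_measure_integrable_cst.
  rewrite -sum_fine => [|i _].
    apply: eq_bigr => i _; under eq_integral do rewrite EFinM.
    rewrite integralZr//; last exact: integrable_indic.
    by rewrite integral_indic// setIT [X in (X * _)%E](PB i) mulrC.
  apply: integrable_fin_num => //; apply: integrable_indicM => //.
  exact: finite_measure_integrable_cst.
rewrite /Rintegral fine_le ?integrable_fin_num//.
rewrite (negligible_integral (measurableC mU) measurableT intf PU).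
rewrite (negligible_integral (measurableC mU) measurableT intg PU).
rewrite setTD setCK; apply: le_integral => //.
- exact: integrableS intf.
- exact: integrableS intg.
- move=> y /[!inE] -[i _ Biy]; rewrite lee_fin /g (bigD1 i)//=.
  rewrite indicE mem_set// mul1r big1 ?addr0 ?fx// => j ji.
  rewrite indicE memNset ?mul0r// => Bjy.
  move/trivIsetP : tB => /(_ i j Logic.I Logic.I).
  by rewrite eq_sym ji => /(_ isT) BB; rewrite -[False]/(set0 y) -BB.
Qed.

Lemma mixture (mu : I -> probability T R) (p : I -> R) :
  (forall i, 0 <= p i) -> \sum_i p i = 1 ->
  exists P : probability T R, forall A, P A = (\sum_i (p i)%:E * mu i A)%E.
Proof.
move=> p0 p1.
pose m k : {measure set T -> \bar R} :=
  if (insub k : option 'I_#|I|) is Some j then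
    mscale (NngNum (p0 (enum_val j))) (mu (enum_val j)) else mzero.
pose P := msum m #|I|.
have PE A : P A = (\sum_i (p i)%:E * mu i A)%E.
  rewrite /P /msum [RHS](reindex_onto enum_val enum_rank)/=; last first.
    by move=> i _; rewrite enum_rankK.
  apply: eq_big => [k|k _]; first by rewrite enum_valK eqxx.
  by rewrite /m valK.
have P1 : P [set: T] = 1%E.
  rewrite PE; under eq_bigr do rewrite probability_setT mule1.
  by rewrite sumEFin p1.
pose Q : probability T R := HB.pack P (Measure_isProbability.Build _ _ _ P P1).
by exists Q.
Qed.

End FiniteIntegrals.

(** * Controls induced by noisy utilities *)
Section Noise.
Context {R : realType} {M : mdp R}.
Local Notation S := (state M).
Local Notation A := (action M).
Local Notation noise := (#|A|.-tuple R).
Implicit Types (d : probability noise R) (psi : noise -> A) (w : A -> R).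

Definition measurable_rule psi : Prop :=
  forall a, measurable [set e | psi e = a].

Definition noise_control d psi : (A -> R) * R :=
  (fun a => fine (d [set e | psi e = a]), \int[d]_e noise_at e (psi e)).

Lemma measurable_noise_at a : measurable_fun setT (fun e : noise => noise_at e a).
Proof. exact: measurable_tnth. Qed.

Lemma measurable_utility w a :
  measurable_fun setT (fun e : noise => w a + noise_at e a).
Proof. by apply: measurable_funD => //; exact: measurable_noise_at. Qed.

Lemma measurable_noisy_argmax w a : measurable [set e | noisy_argmax w e a].
Proof.
rewrite (_ : [set e | _] = \bigcap_(b in [set: A])
    [set e | w b + noise_at e b <= w a + noise_at e a]).
  apply: fin_bigcap_measurable => [|b _]; first exact: finite_finset.
  by apply: measurable_le_set; exact: measurable_utility.
by apply/seteqP; split => e /= h b; [move=> _; exact: h|exact: (h b)].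
Qed.

Lemma argmax_rule w : exists psi, measurable_rule psi /\
  forall e, noisy_argmax w e (psi e).
Proof.
have /card_gt0P[a0 _] := action_gt0 M.
apply: (measurable_selection a0 (F := fun a => [set e | noisy_argmax w e a])).
  exact: measurable_noisy_argmax.
move=> e; exists [arg max_(a > a0) (w a + noise_at e a)]%O => /= b.
by case: arg_maxP => // a _; exact.
Qed.

Lemma tie_null d w a b : continuous_noise d -> a != b ->
  d [set e | w a + noise_at e a = w b + noise_at e b] = 0%E.
Proof.
move=> cd ab; have -> : [set e : noise | w a + noise_at e a = w b + noise_at e b] =
    [set e : noise | tnth e (enum_rank a) = tnth e (enum_rank b) + (w b - w a)].
  apply/seteqP; split => e /=; rewrite /noise_at => h.
    by apply: (addrI (w a)); rewrite h; ring.
  by rewrite h; ring.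
apply: cd; last first.
  by apply: lebesgue_tuple_tie; rewrite (inj_eq enum_rank_inj).
rewrite (_ : [set e | _] =
   [set e : noise | tnth e (enum_rank a) <= tnth e (enum_rank b) + (w b - w a)] `&`
   [set e : noise | tnth e (enum_rank b) + (w b - w a) <= tnth e (enum_rank a)]).
  by apply: measurableI; apply: measurable_le_set => //;
    do ?apply: measurable_funD => //; exact: measurable_tnth.
apply/seteqP; split => e /=; first by move=> ->.
by move=> [h1 h2]; apply/eqP; rewrite eq_le h1.
Qed.

Section Rule.
Variables (d : probability noise R) (psi : noise -> A).
Hypotheses (id : integrable_noise d) (mpsi : measurable_rule psi).

Lemma integrable_noise_rule :
  d.-integrable setT (EFin \o (fun e => noise_at e (psi e))).
Proof. exact: (integrable_select (h := fun a e => noise_at e a)). Qed.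

Lemma integrable_cst_rule (h : A -> R) :
  d.-integrable setT (EFin \o (fun e => h (psi e))).
Proof.
apply: (integrable_select (h := fun a _ => h a)) => // a.
exact: finite_measure_integrable_cst.
Qed.

Lemma integrable_utility_rule w :
  d.-integrable setT (EFin \o (fun e => w (psi e) + noise_at e (psi e))).
Proof.
by have := integrableD measurableT (integrable_cst_rule w) integrable_noise_rule;
  apply: eq_integrable.
Qed.

Lemma Rintegral_utility w :
  \int[d]_e (w (psi e) + noise_at e (psi e)) = payoff w (noise_control d psi).
Proof.
rewrite RintegralD//; [|exact: integrable_cst_rule|exact: integrable_noise_rule].
by rewrite Rintegral_select_cst.
Qed.

Lemma noise_control_simplex : simplex (noise_control d psi).1.
Proof.
split => [a|]; first by rewrite fine_ge0.
have := Rintegral_select_cst d (fun=> 1) mpsi.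
rewrite Rintegral_cst// mul1r [X in fine X](probability_setT d) /= => h.
rewrite [RHS]h.
by apply: eq_bigr => a _; rewrite mul1r.
Qed.

End Rule.

(** With [payoff_le_expected_max]: the expected maximum is the best payoff over all
decision rules, and it is attained by any measurable argmax rule. *)
Lemma expected_max_rule d psi w : integrable_noise d -> measurable_rule psi ->
  (forall e, noisy_argmax w e (psi e)) ->
  expected_max w d = (payoff w (noise_control d psi))%:E.
Proof.
move=> id mpsi psimax; rewrite -Rintegral_utility// /Rintegral fineK; last first.
  by apply: integrable_fin_num => //; exact: integrable_utility_rule.
apply: eq_integral => e _; apply/eqP; rewrite eq_le; apply/andP; split.
  by apply: bigmax_le => [|a _]; rewrite ?leNye// lee_fin; exact: psimax.
exact: (le_bigmax _ (fun a => (w a + noise_at e a)%:E)).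
Qed.

Lemma payoff_le_expected_max d psi w : integrable_noise d ->
  measurable_rule psi -> ((payoff w (noise_control d psi))%:E <= expected_max w d)%E.
Proof.
move=> id mpsi; have [psi' [mpsi' max']] := argmax_rule w.
rewrite (expected_max_rule id mpsi' max') lee_fin -!Rintegral_utility//.
apply: le_Rintegral => //; try exact: integrable_utility_rule.
by move=> e _; exact: max'.
Qed.

Lemma expected_max_fin d w : integrable_noise d -> expected_max w d \is a fin_num.
Proof.
move=> id; have [psi [mpsi psimax]] := argmax_rule w.
by rewrite (expected_max_rule id mpsi psimax).
Qed.

(** The probability that a is optimal does not depend on how ties are broken,
because ties are null for an absolutely continuous law. *)
Lemma choice_probability d psi w a : continuous_noise d -> measurable_rule psi ->
  (forall e, noisy_argmax w e (psi e)) ->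
  d [set e | noisy_argmax w e a] = ((noise_control d psi).1 a)%:E.
Proof.
move=> cd mpsi psimax; rewrite /= fineK ?fin_num_measure//.
apply/eqP; rewrite eq_le; apply/andP; split; last first.
  apply: le_measure; rewrite ?inE//; first exact: measurable_noisy_argmax.
  by move=> e /= <-.
pose tie b : set noise :=
  if a != b then [set e | w a + noise_at e a = w b + noise_at e b] else set0.
have mtie b : measurable (tie b).
  rewrite /tie; case: ifP => // _.
  rewrite (_ : [set e | _] =
    [set e : noise | w a + noise_at e a <= w b + noise_at e b] `&`
    [set e : noise | w b + noise_at e b <= w a + noise_at e a]).
    by apply: measurableI; apply: measurable_le_set; exact: measurable_utility.
  apply/seteqP; split => e /=; first by move=> ->.
  by move=> [h1 h2]; apply/eqP; rewrite eq_le h1.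
have tie0 b : d (tie b) = 0%E.
  by rewrite /tie; case: ifP => [ab|_]; rewrite ?measure0// tie_null.
pose N := \big[setU/set0]_b tie b.
have [mN dN] : measurable N /\ d N = 0%E.
  rewrite /N; elim/big_ind : _ => //.
  move=> X Y [mX dX] [mY dY]; split; first exact: measurableU.
  apply/eqP; rewrite -measure_le0.
  apply: (@le_trans _ _ (d X + d Y)%E); first exact: measureU2.
  by rewrite dX dY adde0.
apply: (@le_trans _ _ (d ([set e | psi e = a] `|` N))).
  apply: le_measure; rewrite ?inE//; first exact: measurable_noisy_argmax.
    exact: measurableU.
  move=> e /= amax; have [<-|pa] := eqVneq (psi e) a; first by left.
  right; rewrite /N -bigcup_seq/=; exists (psi e); first exact: mem_index_enum.
  rewrite /tie eq_sym pa /=; apply/eqP; rewrite eq_le.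
  by rewrite psimax// amax.
apply: (@le_trans _ _ (d [set e | psi e = a] + d N)%E); first exact: measureU2.
by rewrite dN adde0.
Qed.

End Noise.

(** * The frameworks as families of control sets *)
Section ModelControls.
Context {R : realType} {M : mdp R}.
Local Notation S := (state M).
Local Notation A := (action M).
Local Notation noise := (#|A|.-tuple R).
Implicit Types (d : probability noise R) (w : A -> R).

Definition reg_controls (phi : (A -> R) -> R) : set ((A -> R) * R) :=
  [set (p, phi p) | p in @simplex R M].

Definition noisy_controls (Xi : set (probability noise R)) :
    set ((A -> R) * R) :=
  [set u | exists d psi,
    [/\ Xi d, measurable_rule psi & u = noise_control d psi]].

Lemma rmdp_value_control (X : rmdp M) r s :
  rmdp_value X r s = control_value (fun s => reg_controls (reg X s)) r s.
Proof.
have ret (pi : nat -> S -> A -> R) : (forall t, policies (pi t)) ->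
    rmdp_return (reg X) r pi s =
    control_return r (fun t s => (pi t s, reg X s (pi t s))) s.
  move=> ppi; congr (discounted_return _ _ s).
  apply/funext => t; apply/funext => s'; rewrite /payoff/=.
  have [_ pi1] := ppi t s'.
  rewrite -[X in _ = _ + X]mul1r -{1}pi1 mulr_suml -big_split/=.
  by apply: eq_bigr => a _; ring.
congr ereal_sup; apply/seteqP; split => [x|x] /= [].
  move=> pi ppi <-; exists (fun t s => (pi t s, reg X s (pi t s))).
    by move=> t s'; exists (pi t s') => //; exact: ppi.
  by rewrite ret.
move=> u uC <-.
have pu t : policies (fun s => (u t s).1).
  by move=> s'; have [p sp <-] := uC t s'.
exists (fun t s => (u t s).1) => //; rewrite ret//; congr control_return.
by apply/funext => t; apply/funext => s'; have [p sp <-] := uC t s'.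
Qed.

Lemma noisy_return_control (d : nat -> S -> probability noise R) r
    (psi : nat -> S -> noise -> A) s :
  (forall t s, integrable_noise (d t s)) ->
  (forall t s, measurable_rule (psi t s)) ->
  noisy_return d r psi s =
  control_return r (fun t s => noise_control (d t s) (psi t s)) s.
Proof.
move=> id mpsi; congr (discounted_return _ _ s); apply/funext => t.
  apply/funext => s'; apply/funext => s''.
  rewrite (Rintegral_select_cst _ (fun a => trans s' a s'')); last exact: mpsi.
  by apply: eq_bigr => a _; rewrite mulrC.
by apply/funext => s'; rewrite -Rintegral_utility.
Qed.

Lemma ds_value_control (Xi : S -> set (probability noise R)) r s :
  (forall s d, Xi s d -> integrable_noise d) ->
  ds_value Xi r s = control_value (fun s => noisy_controls (Xi s)) r s.
Proof.
move=> iXi; apply/eqP; rewrite eq_le; apply/andP; split.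
  apply: ge_ereal_sup => _ [d dXi <-]; apply: ge_ereal_sup => _ [psi mpsi <-].
  apply: ereal_sup_ubound => /=.
  exists (fun t s => noise_control (d t s) (psi t s)).
    by move=> t s'; exists (d t s'), (psi t s'); split => //; exact: mpsi.
  by rewrite noisy_return_control// => t s'; exact: iXi (dXi t s').
apply: ge_ereal_sup => _ [u uC <-].
have /choice[dp dpP] : forall ts : nat * S,
    exists dp : probability noise R * (noise -> A),
    [/\ Xi ts.2 dp.1, measurable_rule dp.2 &
        u ts.1 ts.2 = noise_control dp.1 dp.2].
  by move=> [t s']; have [d [psi h]] := uC t s'; exists (d, psi).
pose d t s := (dp (t, s)).1; pose psi t s := (dp (t, s)).2.
apply: (@le_trans _ _ (noisy_value d r s)); last first.
  apply: ereal_sup_ubound; exists d => // t s'.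
  by have [] := dpP (t, s').
apply: ereal_sup_ubound; exists psi.
  by move=> t s' a; have [_ + _] := dpP (t, s'); apply.
rewrite noisy_return_control; last 2 first.
- by move=> t s'; have [Xid _ _] := dpP (t, s'); exact: iXi Xid.
- by move=> t s'; have [_ ? _] := dpP (t, s').
congr control_return; apply/funext => t; apply/funext => s'.
by have [_ _ ->] := dpP (t, s').
Qed.

Lemma smdp_value_ds (X : smdp M) r s :
  smdp_value X r s = ds_value (fun s => [set noise_law X s]) r s.
Proof.
rewrite /ds_value (_ : [set d | _] = [set fun=> noise_law X]).
  by rewrite image_set1 ereal_sup1.
apply/seteqP; split => [d /= dX|_ -> //].
by apply/funext => t; apply/funext => s'; exact: dX.
Qed.

Section Surplus.
Variable Xi : set (probability noise R).
Hypotheses (Xi0 : Xi !=set0) (iXi : forall d, Xi d -> integrable_noise d).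

Lemma noisy_controls_neq0 : noisy_controls Xi !=set0.
Proof.
have [d Xid] := Xi0; have [psi [mpsi _]] := argmax_rule (fun _ : A => 0 : R).
by exists (noise_control d psi), d, psi.
Qed.

Lemma noisy_controls_simplex u : noisy_controls Xi u -> simplex u.1.
Proof. by move=> [d [psi [Xid mpsi ->]]]; exact: noise_control_simplex. Qed.

Lemma noisy_controls_feasible w k :
  (forall d, Xi d -> (expected_max w d <= k%:E)%E) -> feasible (noisy_controls Xi).
Proof.
move=> Xik; split; [exact: noisy_controls_neq0|exact: noisy_controls_simplex|].
exists (k + \sum_a `|w a|) => _ [d [psi [Xid mpsi ->]]].
have := le_trans (payoff_le_expected_max w (iXi Xid) mpsi) (Xik _ Xid).
rewrite lee_fin => h; rewrite -lerBlDr (le_trans _ h)// /payoff lerBlDr.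
rewrite addrAC lerDr -lerBlDr sub0r; apply: simplex_mean_ge.
exact: noise_control_simplex.
Qed.

Hypothesis fXi : feasible (noisy_controls Xi).

Lemma expected_max_le_support d w : Xi d ->
  (expected_max w d <= (support_fun (noisy_controls Xi) w)%:E)%E.
Proof.
move=> Xid; have [psi [mpsi psimax]] := argmax_rule w.
rewrite (expected_max_rule (iXi Xid) mpsi psimax) lee_fin support_ge//.
by exists d, psi.
Qed.

(** Maximizing over the law and then over the decision rule amounts to maximizing
over the controls. *)
Lemma surplus_support w : surplus Xi w = (support_fun (noisy_controls Xi) w)%:E.
Proof.
apply/eqP; rewrite eq_le; apply/andP; split.
  by apply: ge_ereal_sup => _ [d Xid <-]; exact: expected_max_le_support.
apply/lee_addgt0Pr => e e0.
have [_ [d [psi [Xid mpsi ->]]] /ltW ge] := support_approx w fXi e0.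
rewrite -leeBlDr// -EFinB.
apply: (@le_trans _ _ (expected_max w d)).
  apply: (le_trans _ (payoff_le_expected_max w (iXi Xid) mpsi)).
  by rewrite lee_fin.
by apply: ereal_sup_ubound; exists d.
Qed.

End Surplus.

Lemma dsmdp_feasible (X : dsmdp M) s : feasible (noisy_controls (ambiguity X s)).
Proof.
move: s; apply: control_value_feasible => [s|s u|s].
- by apply: noisy_controls_neq0; exact: ambiguity_neq0.
- exact: noisy_controls_simplex.
- rewrite -ds_value_control; last exact: ambiguity_integrable.
  by rewrite ltey_eq ds_value_fin.
Qed.

Section Argmax.
Variable phi : (A -> R) -> R.
Hypothesis ne : forall w, @reg_argmax R M phi w !=set0.

Lemma reg_controls_feasible : feasible (reg_controls phi).
Proof.
have [p [sp pmax]] := ne (fun=> 0).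
split; first by exists (p, phi p), p.
- by move=> _ [q sq <-].
- exists (payoff (fun=> 0) (p, phi p)) => _ [q sq <-] /=.
  apply: le_trans (pmax _ sq).
  by rewrite big1 ?add0r// => a _; rewrite mul0r.
Qed.

(** This support function is the convex conjugate of - phi. *)
Lemma support_reg_controls w p : reg_argmax phi w p ->
  support_fun (reg_controls phi) w = payoff w (p, phi p).
Proof.
move=> [sp pmax]; apply/eqP; rewrite eq_le; apply/andP; split.
  apply: support_le; first exact: reg_controls_feasible.
  by move=> _ [q sq <-]; exact: pmax.
by apply: support_ge; [exact: reg_controls_feasible|exists p].
Qed.

End Argmax.

End ModelControls.

(** * Conjugate regularizers *)
Section Conjugate.
Context {R : realType} {M : mdp R}.
Local Notation A := (action M).
Implicit Types (p w : A -> R).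
Variable F : (A -> R) -> R.

Definition conjugate p : R := inf [set F w - \sum_a w a * p a | w in [set: A -> R]].

Definition subgradient w p : Prop :=
  forall w', F w + \sum_a (w' a - w a) * p a <= F w'.

(* Without this minorant the infimum defining the conjugate could be -oo at some
   points of the simplex. *)
Hypothesis Fge : forall a, exists m, forall w, w a + m <= F w.

Lemma conjugate_has_lbound p : simplex p ->
  has_lbound [set F w - \sum_a w a * p a | w in [set: A -> R]].
Proof.
move=> [p0 p1]; have /choice[m Fm] := Fge.
exists (\sum_a m a * p a) => _ [w _ <-].
rewrite lerBrDr -big_split/= -[leRHS]mulr1 -p1 mulr_sumr.
apply: ler_sum => a _; rewrite -mulrDl ler_wpM2r ?p0//.
by rewrite addrC Fm.
Qed.

Lemma conjugate_le w p : simplex p -> conjugate p <= F w - \sum_a w a * p a.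
Proof. by move=> sp; apply: ge_inf; [exact: conjugate_has_lbound|exists w]. Qed.

Lemma conjugate_ge p k :
  (forall w, k <= F w - \sum_a w a * p a) -> k <= conjugate p.
Proof.
move=> kF; apply: lb_le_inf; first by exists (F (fun=> 0) - \sum_a 0 * p a), (fun=> 0).
by move=> _ [w _ <-].
Qed.

Lemma conjugate_concave : @concave_on_simplex R M conjugate.
Proof.
move=> p p' t sp sp' /andP[t0 t1]; apply: conjugate_ge => w.
rewrite (_ : F w - _ = t * (F w - \sum_a w a * p a) +
                       (1 - t) * (F w - \sum_a w a * p' a)).
  by rewrite lerD// ler_wpM2l ?subr_ge0// conjugate_le.
rewrite (_ : \sum_a w a * (t * p a + (1 - t) * p' a) =
    t * (\sum_a w a * p a) + (1 - t) * (\sum_a w a * p' a)); first by ring.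
by rewrite !mulr_sumr -big_split/=; apply: eq_bigr => a _; ring.
Qed.

Lemma subgradient_conjugate w p : simplex p -> subgradient w p ->
  conjugate p = F w - \sum_a w a * p a.
Proof.
move=> sp Fwp; apply/eqP; rewrite eq_le conjugate_le//=.
apply: conjugate_ge => w'; rewrite lerBrDr addrAC -addrA -sumrB.
by under eq_bigr do rewrite -mulrBl; exact: Fwp.
Qed.

(** Equality in the Fenchel inequality: the argmax of the conjugate regularizer at w
contains the subgradients of F at w that lie in the simplex. *)
Lemma subgradient_reg_argmax w p : simplex p -> subgradient w p ->
  @reg_argmax R M conjugate w p.
Proof.
move=> sp Fwp; split => // q sq; rewrite (subgradient_conjugate sp Fwp) subrKC.
by have := conjugate_le w sq; rewrite lerBrDl.
Qed.

End Conjugate.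

(** * Limits of maximizing sequences of laws *)
Section Subsequence.
Context {R : realType}.

Lemma increasing_seq_cvg (f : nat -> nat) : increasing_seq f -> f @ \oo --> \oo.
Proof.
move=> incf; have fge n : (n <= f n)%N.
  elim: n => // n IH; apply: (leq_ltn_trans IH).
  have /increasing_seqP := incf; exact.
by move=> B [N _ NB]; exists N => // n /= Nn; apply: NB; exact: leq_trans (fge n).
Qed.

Lemma bolzano_weierstrass_seq (T : eqType) (s : seq T) (u : nat -> T -> R) :
  (forall a, bounded_fun (u ^~ a)) ->
  exists2 f : nat -> nat, increasing_seq f &
    forall a, a \in s -> cvgn (fun n => u (f n) a).
Proof.
move=> bu; elim: s => [|a s [f incf fs]]; first by exists id.
have bf : bounded_fun (fun n => u (f n) a).
  by have [K [Kr Ku]] := bu a; exists K; split => // x Kx n _; exact: Ku.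
have [g incg ga] := bolzano_weierstrass bf.
exists (f \o g) => [n m|b]; first by rewrite /= incf -leEnat incg.
rewrite inE => /predU1P[->//|/fs/cvg_ex[l ul]]; apply/cvg_ex; exists l.
exact: (cvg_comp _ _ (increasing_seq_cvg incg) ul).
Qed.

End Subsequence.

Section DistributionalToRegularized.
Context {R : realType} {M : mdp R}.
Local Notation S := (state M).
Local Notation A := (action M).
Local Notation noise := (#|A|.-tuple R).
Variable X : dsmdp M.
Let C s := noisy_controls (ambiguity X s).
Let F s := support_fun (C s).

Lemma cvg_payoff (u : nat -> A -> R) (p w : A -> R) :
  (forall a, u n a @[n --> \oo] --> p a) ->
  \sum_a w a * u n a @[n --> \oo] --> \sum_a w a * p a.
Proof.
move=> up; apply: cvg_big => [|a _]; first exact: add_continuous.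
by apply: cvgMl_tmp; exact: up.
Qed.

(** An argmax rule for w stays available at any w', so under each law d n the choice
probabilities bound the expected maximum at w' from below by an affine function of
w'. In the limit this is the subgradient inequality for the surplus. *)
Lemma maximizing_limit_subgradient s w (d : nat -> probability noise R) p :
  (forall n, ambiguity X s (d n)) ->
  expected_max w (d n) @[n --> \oo] --> surplus (ambiguity X s) w ->
  (forall a, d n [set e | noisy_argmax w e a] @[n --> \oo] --> (p a)%:E) ->
  simplex p /\ subgradient (F s) w p.
Proof.
move=> dX dF dp; have fC := dsmdp_feasible X s.
have iX := @ambiguity_integrable _ _ X.
have [psi [mpsi psimax]] := argmax_rule w.
pose u n := noise_control (d n) psi.
have Cu n : C s (u n) by exists (d n), psi.
have up a : (u n).1 a @[n --> \oo] --> p a.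
  have := dp a; rewrite (_ : (fun n => _) = EFin \o (fun n => (u n).1 a)).
    by move/fine_cvg.
  apply/funext => n; apply: choice_probability => //.
  exact: ambiguity_continuous (dX n).
have uF : payoff w (u n) @[n --> \oo] --> F s w.
  move: dF; rewrite (surplus_support (iX _) fC).
  rewrite (_ : (fun n => _) = EFin \o (fun n => payoff w (u n))).
    by move/fine_cvg.
  by apply/funext => n; apply: expected_max_rule => //; exact: iX (dX n).
have [_ sC _] := fC.
split.
  split => [a|].
    by apply: (cvgr_to_ge (up a)); apply: nearW => n; case: (sC _ (Cu n)).
  have : \sum_a 1 * (u n).1 a @[n --> \oo] --> \sum_a 1 * p a by exact: cvg_payoff.
  under eq_bigr do rewrite mul1r.
  under eq_cvg => n do under eq_bigr do rewrite mul1r.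
  move=> up1; have u1 n : \sum_a (u n).1 a = 1 by case: (sC _ (Cu n)).
  apply/eqP; rewrite eq_le (cvgr_to_le up1) ?(cvgr_to_ge up1)//;
    by apply: nearW => n; rewrite u1.
move=> w'.
have : payoff w (u n) + \sum_a (w' a - w a) * (u n).1 a @[n --> \oo] -->
       F s w + \sum_a (w' a - w a) * p a.
  by apply: cvgD => //; exact: cvg_payoff.
move/cvgr_to_le; apply; apply: nearW => n.
apply: le_trans (support_ge w' fC (Cu n)).
rewrite /payoff addrAC -big_split/=.
by under eq_bigr do rewrite -mulrDl addrC subrK.
Qed.

(** Maximizing laws need not converge, but their choice probabilities lie in [0, 1]
for each of the finitely many actions, so a subsequence of them converges. *)
Lemma maximizing_limit_exists s w : exists p (d : nat -> probability noise R),
  [/\ forall n, ambiguity X s (d n),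
      expected_max w (d n) @[n --> \oo] --> surplus (ambiguity X s) w &
      forall a, d n [set e | noisy_argmax w e a] @[n --> \oo] --> (p a)%:E].
Proof.
have fC := dsmdp_feasible X s; have iX := @ambiguity_integrable _ _ X.
have sF := surplus_support (iX _) fC w.
have /choice[d dP] : forall n : nat, exists d, ambiguity X s d /\
    ((F s w - n.+1%:R^-1)%:E <= expected_max w d)%E.
  move=> n; have n0 : 0 < n.+1%:R^-1 :> R by rewrite invr_gt0.
  have [_ [d [psi [Xd mpsi ->]]] /ltW ge] := support_approx w fC n0.
  exists d; split => //.
  apply: (le_trans _ (payoff_le_expected_max w (iX _ _ Xd) mpsi)).
  by rewrite lee_fin.
pose u n a := fine (d n [set e | noisy_argmax w e a]).
have [a|f incf fu] := bolzano_weierstrass_seq (enum A) (u := u).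
  exists 1; split; first exact: num_real.
  move=> y y1 n _; rewrite /u /= ger0_norm ?fine_ge0// (le_trans _ (ltW y1))//.
  rewrite -lee_fin fineK ?probability_le1 ?fin_num_measure//;
    exact: measurable_noisy_argmax.
exists (fun a => lim (u (f n) a @[n --> \oo])), (d \o f); split => [n|| a].
- by case: (dP (f n)).
- rewrite sF; apply: (@squeeze_cvge _ _ _ _
    (fun n => (F s w - (f n).+1%:R^-1)%:E) _ (fun=> (F s w)%:E)).
  + apply: nearW => n; have [Xd ge] := dP (f n); rewrite ge/=.
    exact: (expected_max_le_support (iX _) fC w Xd).
  + apply: (@cvg_comp _ _ _ f (fun n => (F s w - n.+1%:R^-1)%:E) _ _ _
      (increasing_seq_cvg incf)).
    apply: cvg_EFin; first exact: nearW.
    rewrite -[X in _ --> X]subr0; apply: cvgB; first exact: cvg_cst.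
    exact: cvg_harmonic.
  + exact: cvg_cst.
- apply: cvg_EFin.
    by apply: nearW => n; rewrite fin_num_measure//; exact: measurable_noisy_argmax.
  by apply: fu; rewrite mem_enum.
Qed.

End DistributionalToRegularized.

(** * Spiked noise *)
Section SpikedNoise.
Context {R : realType} {M : mdp R}.
Local Notation A := (action M).
Local Notation noise := (#|A|.-tuple R).
Implicit Types (p w : A -> R) (h L dl : R).

(** Noise vectors under which a wins by almost L. Intervals of length dl in place of
points keep the law absolutely continuous. *)
Definition spike h L dl (a : A) : set noise :=
  box (fun i => if i == enum_rank a then h else h - L) dl.

Lemma spikeP h L dl a (e : noise) : spike h L dl a e <->
  forall b, (if b == a then h else h - L) - dl <= noise_at e b
            <= (if b == a then h else h - L).
Proof.
split => [ea b|ea i].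
  by have := ea (enum_rank b); rewrite (inj_eq val_inj) (inj_eq enum_rank_inj).
have := ea (enum_val i); rewrite /noise_at enum_valK.
by rewrite -(inj_eq enum_rank_inj) enum_valK.
Qed.

Lemma spike_disjoint h L dl : dl < L -> trivIset setT (spike h L dl).
Proof.
move=> dlL; apply/trivIsetP => a b _ _ ab; apply/seteqP; split => // e [].
move=> /spikeP/(_ a) + /spikeP/(_ a); rewrite eqxx (negbTE ab).
by move=> /andP[h1 _] /andP[_ h2]; lra.
Qed.

Lemma spiked_noise p h L dl : @simplex R M p -> 0 < dl -> dl < L ->
  exists d : probability noise R, [/\ continuous_noise d, integrable_noise d &
    forall a, d (spike h L dl a) = (p a)%:E].
Proof.
move=> [p0 p1] dl0 dlL.
have mspike a : measurable (spike h L dl a) by exact: measurable_box.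
have dspike := spike_disjoint (h := h) dlL.
have /choice[mu muP] := fun a : A => uniform_box #|A|
  (fun i => if i == enum_rank a then h else h - L) dl0.
have [d dE] := mixture mu p0 p1.
have dspikeE a : d (spike h L dl a) = (p a)%:E.
  rewrite dE (bigD1 a)//= big1 ?adde0 => [|b ba].
    by have [mua _] := muP a; rewrite [X in (_ * X)%E]mua mule1.
  have [mub _] := muP b.
  suff -> : mu b (spike h L dl a) = 0%E by rewrite mule0.
  apply: (subset_measure0 (B := ~` spike h L dl b)) => //.
  - exact: measurableC.
  - move=> e ea eb; move/trivIsetP : dspike => /(_ a b Logic.I Logic.I).
    by rewrite eq_sym ba => /(_ isT) ab; rewrite -[False]/(set0 e) -ab.
  - by rewrite [LHS]probability_setC// [X in (_ - X)%E]mub subee.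
exists d; split => //.
  move=> B mB B0; rewrite dE big1// => a _.
  have [_ [K K0 /(_ B mB)]] := muP a; rewrite B0 mule0 => muB.
  have /eqP -> : mu a B == 0%E by rewrite -measure_le0.
  by rewrite mule0.
move=> b; pose U := \bigcup_(a in [set: A]) spike h L dl a.
apply: (integrable_on_full (U := U) (K := `|h| + `|L| + dl)).
- by apply: fin_bigcup_measurable => //; exact: finite_finset.
- exact: (probability_finite_cover mspike dspike dspikeE p1).
- exact: measurable_noise_at.
- move=> e [a _ /spikeP/(_ b)].
  have := ler_norm h; have := ler_norm (- h); rewrite normrN.
  have := ler_norm L; rewrite ler_norml.
  by case: ifP => _ ? ? ? /andP[? ?]; apply/andP; split; lra.
Qed.

Section Spiked.
Variables (p : A -> R) (h L dl : R) (d : probability noise R).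
Hypotheses (sp : @simplex R M p) (dlL : dl < L).
Hypotheses (cd : continuous_noise d) (id : integrable_noise d).
Hypothesis dspike : forall a, d (spike h L dl a) = (p a)%:E.

Let mspike a : measurable (spike h L dl a). Proof. exact: measurable_box. Qed.

Lemma spiked_expected_max_le w W : (forall a, w a <= W) ->
  (expected_max w d <= (\sum_a Num.max (w a + h) (W + h - L) * p a)%:E)%E.
Proof.
move=> wW; have [psi [mpsi psimax]] := argmax_rule w.
rewrite (expected_max_rule id mpsi psimax) lee_fin -Rintegral_utility//.
have [_ p1] := sp.
apply: (Rintegral_le_cover mspike (spike_disjoint (h := h) dlL) dspike p1).
  exact: integrable_utility_rule.
move=> a e /spikeP/(_ (psi e)); case: eqP => [->|_] /andP[_ he].
  by rewrite le_max lerD2l he.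
by rewrite le_max; apply/orP; right; rewrite -addrA lerD.
Qed.

Lemma spiked_expected_max_ge w :
  ((payoff w (p, h) - dl)%:E <= expected_max w d)%E.
Proof.
have [psi [mpsi psimax]] := argmax_rule w.
rewrite (expected_max_rule id mpsi psimax) lee_fin -Rintegral_utility//.
have [_ p1] := sp; have iu := integrable_utility_rule id mpsi w.
(* The lower bound is the upper bound for the opposite function. *)
have := Rintegral_le_cover (x := fun a => - (w a + h - dl))
  (f := fun e => - 1 * (w (psi e) + noise_at e (psi e)))
  mspike (spike_disjoint (h := h) dlL) dspike p1.
rewrite (RintegralZl _ measurableT iu) mulN1r lerNl => H.
apply: le_trans (H _ _).
- rewrite -sumrN (eq_bigr (fun a => w a * p a + (h - dl) * p a)) => [|a _].
    by rewrite big_split/= -mulr_sumr p1 mulr1 addrA.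
  by ring.
- by have := integrableZl measurableT (-1) iu; apply: eq_integrable.
- move=> a e /spikeP/(_ a); rewrite eqxx mulN1r lerN2 => /andP[he _].
  by apply: le_trans (psimax e a); rewrite -addrA lerD2l.
Qed.

(** When L exceeds all the differences of utilities by dl, a is the only optimal
action on the spike of a. So the choice probabilities are at least p, and both
sum to 1. *)
Lemma spiked_choice w a : (forall a b, w b - w a + dl < L) ->
  d [set e | noisy_argmax w e a] = (p a)%:E.
Proof.
move=> wL; have [psi [mpsi psimax]] := argmax_rule w.
rewrite (choice_probability a cd mpsi psimax); congr EFin.
have ge b : p b <= (noise_control d psi).1 b.
  rewrite -lee_fin -dspike /= fineK ?fin_num_measure//.
  apply: le_measure; rewrite ?inE//.
  move=> e /spikeP eb /=; apply/eqP/negPn/negP => ne.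
  have := psimax e b; have /andP[_] := eb (psi e); have /andP[+ _] := eb b.
  by rewrite eqxx (negbTE ne); have := wL b (psi e); lra.
have [_ n1] := noise_control_simplex d mpsi; have [_ p1] := sp.
have sum0 : \sum_b ((noise_control d psi).1 b - p b) = 0.
  by rewrite sumrB n1 p1 subrr.
have pos b : true -> 0 <= (noise_control d psi).1 b - p b by rewrite subr_ge0 ge.
by apply/eqP; rewrite -subr_eq0; apply/eqP; exact: (psumr_eq0P pos sum0).
Qed.

End Spiked.
End SpikedNoise.

(** * From regularizers to ambiguity sets *)
Section RegularizedToDistributional.
Context {R : realType} {M : mdp R}.
Local Notation S := (state M).
Local Notation A := (action M).
Local Notation noise := (#|A|.-tuple R).

Section State.
Variable phi : (A -> R) -> R.
Hypothesis phi_argmax : forall w, @reg_argmax R M phi w !=set0.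
Let F := support_fun (reg_controls phi).
Let fR : feasible (reg_controls phi) := reg_controls_feasible phi_argmax.

(** The largest ambiguity set of absolutely continuous integrable laws whose surplus
does not exceed F. *)
Definition dominated_noise : set (probability noise R) :=
  [set d | [/\ continuous_noise d, integrable_noise d &
              forall w, (expected_max w d <= (F w)%:E)%E]].

Lemma payoff_le_support w p : simplex p -> payoff w (p, phi p) <= F w.
Proof. by move=> sp; apply: support_ge => //; exists p. Qed.

Lemma support_ge_coordinate : exists m, forall w b, w b + m <= F w.
Proof.
pose phi1 b := - phi (fun a => (a == b)%:R).
exists (- \sum_b `|phi1 b|) => w b.
apply: le_trans (payoff_le_support w (simplex_point b)).
by rewrite /payoff/= point_mean lerD2l lerNl; exact: (le_sum_norm phi1).
Qed.

(** Spiked noise at height h = phi p, for L large. At a point w with maximum W, the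
action drawn contributes at most max (w_a + h, W + h - L). If the first term is
the larger one for all actions of positive probability, the mean is at most
w . p + h <= F w. Otherwise some a of positive probability contributes only
W + h - L, so that the mean is at most W + h - L p_a; this is at most
W + m <= F w as soon as L p_a >= h - m. *)
Lemma dominated_spiked_noise w0 p dl : simplex p -> 0 < dl ->
  exists d, [/\ dominated_noise d,
    ((payoff w0 (p, phi p) - dl)%:E <= expected_max w0 d)%E &
    forall a, d [set e | noisy_argmax w0 e a] = (p a)%:E].
Proof.
move=> sp dl0; have [p0 p1] := sp; have [m Fm] := support_ge_coordinate.
set h := phi p.
(* The first sum gives L p_a >= h - m when p_a > 0 (a zero p_a contributes 0), the
   second one separates the utilities at w0. *)
pose L := \sum_a `|h - m| / p a + \sum_a 2 * `|w0 a| + dl + 1.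
have S1 : 0 <= \sum_a `|h - m| / p a.
  by apply: sumr_ge0 => a _; rewrite divr_ge0.
have S2 : 0 <= \sum_a 2 * `|w0 a| by apply: sumr_ge0 => a _; rewrite mulr_ge0.
have dlL : dl < L by rewrite /L; lra.
have L0 : 0 <= L by rewrite /L; lra.
have Lp a : 0 < p a -> h - m <= L * p a.
  move=> pa; rewrite (le_trans (ler_norm _))// -ler_pdivrMr//.
  have : `|h - m| / p a <= \sum_a `|h - m| / p a.
    rewrite (bigD1 a)//= lerDl; apply: sumr_ge0 => b _.
    by rewrite divr_ge0.
  by rewrite /L; lra.
have Lw a b : w0 b - w0 a + dl < L.
  have le c : 2 * `|w0 c| <= \sum_a 2 * `|w0 a|.
    rewrite (bigD1 c)//= lerDl; apply: sumr_ge0 => ? _.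
    by rewrite mulr_ge0.
  have := le a; have := le b; have := ler_norm (w0 b).
  have := ler_norm (- w0 a); rewrite normrN /L; lra.
have [d [cd id dspike]] := spiked_noise h sp dl0 dlL.
exists d; split; last 2 first.
- exact: (spiked_expected_max_ge sp dlL id dspike w0).
- by move=> a; exact: (spiked_choice sp cd dspike a Lw).
split => // w.
have /card_gt0P[a0 _] := action_gt0 M.
pose bm := [arg max_(b > a0) w b]%O; pose W := w bm.
have wW a : w a <= W by rewrite /W /bm; case: arg_maxP => // b _; apply.
apply: le_trans (spiked_expected_max_le sp dlL id dspike wW) _.
rewrite lee_fin.
have [[a /andP[pa wa]]|nex] :=
    pselect (exists a, (0 < p a) && (w a < W - L)); last first.
  apply: le_trans (payoff_le_support w sp); rewrite /payoff/= -/h.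
  rewrite -[X in _ <= _ + X]mulr1 -p1 mulr_sumr -big_split/=.
  apply: ler_sum => a _; have := p0 a; rewrite le_eqVlt => /predU1P[<-|pa].
    by rewrite !mulr0 addr0.
  rewrite -mulrDl ler_pM2r// ge_max lexx/=.
  have : W - L <= w a.
    by rewrite leNgt; apply/negP => wa; apply: nex; exists a; rewrite pa.
  lra.
apply: le_trans (Fm w bm); rewrite -/W.
have xW b : Num.max (w b + h) (W + h - L) <= W + h.
  by rewrite ge_max lerD2r wW/=; lra.
have xa : Num.max (w a + h) (W + h - L) = W + h - L.
  by apply/max_idPr; lra.
rewrite (bigD1 a)//= xa.
have : \sum_(b | b != a) Num.max (w b + h) (W + h - L) * p b <=
       (W + h) * \sum_(b | b != a) p b.
  by rewrite mulr_sumr; apply: ler_sum => b _; rewrite ler_wpM2r.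
have -> : \sum_(b | b != a) p b = 1 - p a.
  by rewrite -p1 [in RHS](bigD1 a)//= addrAC subrr add0r.
have := Lp a pa; rewrite !mulrBr !mulrBl mulr1; lra.
Qed.

Lemma dominated_noise_neq0 : dominated_noise !=set0.
Proof.
have [p [sp _]] := phi_argmax (fun=> 0).
by have [d [dd _ _]] := dominated_spiked_noise (fun=> 0) sp ltr01; exists d.
Qed.

Lemma dominated_noise_integrable d : dominated_noise d -> integrable_noise d.
Proof. by case. Qed.

Lemma dominated_noise_feasible : feasible (noisy_controls dominated_noise).
Proof.
apply: (noisy_controls_feasible dominated_noise_neq0 dominated_noise_integrable
  (w := fun=> 0) (k := F (fun=> 0))).
by move=> d [_ _]; apply.
Qed.

Lemma support_dominated_noise :
  support_fun (noisy_controls dominated_noise) = F.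
Proof.
apply/funext => w; apply/eqP; rewrite eq_le; apply/andP; split.
  apply: support_le; first exact: dominated_noise_feasible.
  move=> _ [d [psi [[_ id dF] mpsi ->]]]; rewrite -lee_fin.
  by apply: le_trans (dF w); exact: payoff_le_expected_max.
have [p pw] := phi_argmax w; have [sp _] := pw.
rewrite /F (support_reg_controls phi_argmax pw).
apply/ler_addgt0Pr => dl dl0.
have [d [dd ge _]] := dominated_spiked_noise w sp dl0.
rewrite -lerBlDr -lee_fin (le_trans ge)//.
apply: expected_max_le_support => //; first exact: dominated_noise_integrable.
exact: dominated_noise_feasible.
Qed.

Lemma dominated_noise_optimal w p : reg_argmax phi w p ->
  exists d : nat -> probability noise R,
    [/\ forall n, dominated_noise (d n),
        expected_max w (d n) @[n --> \oo] --> surplus dominated_noise w &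
        forall a, d n [set e | noisy_argmax w e a] @[n --> \oo] --> (p a)%:E].
Proof.
move=> pw; have [sp _] := pw.
have /choice[d dP] := fun n => dominated_spiked_noise w sp (harmonic_gt0 (R := R) n).
have fd := dominated_noise_feasible.
have id := dominated_noise_integrable.
exists d; split => [n||a]; first by case: (dP n).
  rewrite (surplus_support id fd) support_dominated_noise.
  apply: (@squeeze_cvge _ _ _ _
    (fun n => (F w - harmonic n)%:E) _ (fun=> (F w)%:E)).
  - apply: nearW => n; have [[cd idn dF] ge _] := dP n.
    by rewrite dF andbT; move: ge; rewrite -(support_reg_controls phi_argmax pw).
  - apply: cvg_EFin; first exact: nearW.
    rewrite -[X in _ --> X]subr0; apply: cvgB; first exact: cvg_cst.
    exact: cvg_harmonic.
  - exact: cvg_cst.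
rewrite (_ : (fun n => _) = fun=> (p a)%:E); first exact: cvg_cst.
by apply/funext => n; have [_ _ ->] := dP n.
Qed.

End State.

Variable X : rmdp M.
Let Xi s := dominated_noise (reg X s).
Let nX s := @reg_argmax_neq0 _ _ X s.

Lemma dominated_ds_value r s : ds_value Xi r s = rmdp_value X r s.
Proof.
rewrite ds_value_control; last by move=> s' d; exact: dominated_noise_integrable.
rewrite rmdp_value_control; apply: control_value_eq => s'.
- exact: dominated_noise_feasible.
- exact: reg_controls_feasible.
- exact: support_dominated_noise.
Qed.

Lemma rmdp_value_fin r s : rmdp_value X r s \is a fin_num.
Proof.
rewrite rmdp_value_control.
have fC s' : feasible (reg_controls (reg X s')) by exact: reg_controls_feasible.
by have [v vfix] := bellman_fixpoint r fC; rewrite (control_value_fixpoint fC vfix).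
Qed.

Lemma dominated_ds_value_fin r s : ds_value Xi r s \is a fin_num.
Proof. by rewrite dominated_ds_value rmdp_value_fin. Qed.

Lemma rmdp_to_dsmdp :
  exists Y : dsmdp M, model_equiv (rmdp_model X) (dsmdp_model Y).
Proof.
exists (@DSMDP R M Xi (fun s => dominated_noise_neq0 (nX s))
  (fun s d (dd : Xi s d) => let: And3 c _ _ := dd in c)
  (fun s d => @dominated_noise_integrable (reg X s) d) dominated_ds_value_fin).
exists (fun _ _ => 0) => r _ /eq_reward <-.
have VE : ds_value Xi r = rmdp_value X r.
  by apply/funext => s; exact: dominated_ds_value.
split => [s|]; first by rewrite /= dominated_ds_value.
have /choice[pi piP] : forall s, exists p,
    reg_argmax (reg X s) (qvalue r (rmdp_value X r) s) p by move=> s; exact: nX.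
exists pi; split => // s /=; rewrite VE.
exact: (dominated_noise_optimal (nX s) (piP s)).
Qed.

End RegularizedToDistributional.

(** * From ambiguity sets to regularizers *)
Section ConjugateModel.
Context {R : realType} {M : mdp R}.
Local Notation S := (state M).
Local Notation A := (action M).
Local Notation noise := (#|A|.-tuple R).
Variable Y : dsmdp M.
Let C s := noisy_controls (ambiguity Y s).
Let F s := support_fun (C s).

(** Always playing a earns w a plus the mean noise of a under any admissible law. *)
Lemma noisy_support_ge_coordinate s a : exists m, forall w, w a + m <= F s w.
Proof.
have [d Yd] := ambiguity_neq0 Y s.
have mpsi : measurable_rule (fun _ : noise => a).
  move=> b; have [->|ab] := eqVneq a b.
    by rewrite (_ : [set _ | _] = setT)//; apply/seteqP.
  rewrite (_ : [set _ | _] = set0)//; apply/seteqP; split => // e /= /eqP.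
  by rewrite (negbTE ab).
exists (noise_control d (fun=> a)).2 => w.
apply: le_trans (support_ge w (dsmdp_feasible Y s) (u := noise_control d (fun=> a)) _).
  rewrite lerD2r -(Rintegral_select_cst _ w)// Rintegral_cst//.
  by rewrite [X in fine X](probability_setT d) mulr1.
by exists d, (fun=> a).
Qed.

Lemma conjugate_argmax_neq0 s w : @reg_argmax R M (conjugate (F s)) w !=set0.
Proof.
have [p [d [dY dF dp]]] := maximizing_limit_exists Y s w.
have [sp Fp] := maximizing_limit_subgradient dY dF dp.
by exists p; apply: subgradient_reg_argmax => //; exact: noisy_support_ge_coordinate.
Qed.

Definition conjugate_rmdp : rmdp M :=
  RMDP (fun s => conjugate_concave (noisy_support_ge_coordinate s))
       conjugate_argmax_neq0.

Lemma conjugate_rmdp_value r s :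
  rmdp_value conjugate_rmdp r s = ds_value (ambiguity Y) r s.
Proof.
rewrite ds_value_control; last exact: ambiguity_integrable.
rewrite rmdp_value_control; apply: control_value_eq => s'.
- exact: (reg_controls_feasible (@conjugate_argmax_neq0 s')).
- exact: dsmdp_feasible.
- apply/funext => w.
  have [p [d [dY dF dp]]] := maximizing_limit_exists Y s' w.
  have [sp Fp] := maximizing_limit_subgradient dY dF dp.
  have sF := noisy_support_ge_coordinate s'.
  rewrite (support_reg_controls (@conjugate_argmax_neq0 s')
    (subgradient_reg_argmax sF sp Fp)).
  by rewrite /payoff/= (subgradient_conjugate sF sp Fp) subrKC.
Qed.

Lemma dsmdp_optimal_conjugate r pi :
  dsmdp_optimal Y r pi -> rmdp_optimal conjugate_rmdp r pi.
Proof.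
move=> Ypi s; have [d [dY dF dp]] := Ypi s.
have VE : rmdp_value conjugate_rmdp r = ds_value (ambiguity Y) r.
  by apply/funext => s'; exact: conjugate_rmdp_value.
rewrite VE; have [sp Fp] := maximizing_limit_subgradient dY dF dp.
by apply: subgradient_reg_argmax => //; exact: noisy_support_ge_coordinate.
Qed.

Lemma dsmdp_optimal_neq0 r : exists pi, dsmdp_optimal Y r pi.
Proof.
have /choice[pi piP] := fun s => maximizing_limit_exists Y s
  (qvalue r (ds_value (ambiguity Y) r) s).
by exists pi.
Qed.

End ConjugateModel.

(** * Equivalences and strictness *)
Section Frameworks.
Context {R : realType} {M : mdp R}.
Local Notation S := (state M).
Local Notation A := (action M).
Local Notation noise := (#|A|.-tuple R).

Lemma dsmdp_to_rmdp (Y : dsmdp M) :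
  model_equiv (rmdp_model (conjugate_rmdp Y)) (dsmdp_model Y).
Proof.
exists (fun _ _ => 0) => r _ /eq_reward <-.
split=> [s|]; first exact: conjugate_rmdp_value.
have [pi Ypi] := dsmdp_optimal_neq0 Y r.
by exists pi; split => //; exact: dsmdp_optimal_conjugate.
Qed.

Section Singleton.
Variable Z : smdp M.
Let Xi (s : S) := [set noise_law Z s].

Lemma singleton_integrable s d : Xi s d -> integrable_noise d.
Proof. by move=> ->; exact: law_integrable. Qed.

Lemma singleton_continuous s d : Xi s d -> continuous_noise d.
Proof. by move=> ->; exact: law_continuous. Qed.

Lemma singleton_neq0 s : Xi s !=set0.
Proof. by exists (noise_law Z s). Qed.

Lemma singleton_feasible s : feasible (noisy_controls (Xi s)).
Proof.
apply: (noisy_controls_feasible (singleton_neq0 s) (@singleton_integrable s)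
  (w := fun=> 0) (k := fine (expected_max (fun=> 0) (noise_law Z s)))).
by move=> _ ->; rewrite fineK//; apply: expected_max_fin; exact: law_integrable.
Qed.

Lemma singleton_ds_value_fin r s : ds_value Xi r s \is a fin_num.
Proof.
rewrite ds_value_control; last exact: singleton_integrable.
have [v vfix] := bellman_fixpoint r singleton_feasible.
by rewrite (control_value_fixpoint singleton_feasible vfix).
Qed.

Definition singleton_dsmdp : dsmdp M :=
  DSMDP singleton_neq0 singleton_continuous singleton_integrable
    singleton_ds_value_fin.

Lemma singleton_optimal r : exists pi,
  smdp_optimal Z r pi /\ dsmdp_optimal singleton_dsmdp r pi.
Proof.
have VE : ds_value (ambiguity singleton_dsmdp) r = smdp_value Z r.
  by apply/funext => s; rewrite smdp_value_ds.
have /choice[psi psiP] := fun s => argmax_rule (qvalue r (smdp_value Z r) s).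
pose pi s := (noise_control (noise_law Z s) (psi s)).1.
exists pi; split.
  exists psi; split => [s a|s e|s a].
  - by case: (psiP s) => + _; apply.
  - by case: (psiP s).
  - by rewrite /pi /= fineK// fin_num_measure//; case: (psiP s) => + _; apply.
move=> s; rewrite VE /=; exists (fun=> noise_law Z s); split => // [|a].
  rewrite (_ : surplus _ _ = expected_max (qvalue r (smdp_value Z r) s) (noise_law Z s)).
    exact: cvg_cst.
  by rewrite /surplus image_set1 ereal_sup1.
have [mpsi psimax] := psiP s.
rewrite (_ : (fun n => _) = fun=> (pi s a)%:E); first exact: cvg_cst.
apply/funext => n; apply: choice_probability => //; exact: law_continuous.
Qed.

Lemma smdp_to_dsmdp : model_equiv (dsmdp_model singleton_dsmdp) (smdp_model Z).
Proof.
exists (fun _ _ => 0) => r _ /eq_reward <-.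
split=> [s|]; first by rewrite /= smdp_value_ds.
by have [pi [Zpi Ypi]] := singleton_optimal r; exists pi.
Qed.

(** Equivalence of models is not transitive a priori, as it asks for one common
policy; here the policy of the stochastic model is optimal in the singleton
model, hence also in the conjugate one. *)
Lemma smdp_to_rmdp :
  model_equiv (rmdp_model (conjugate_rmdp singleton_dsmdp)) (smdp_model Z).
Proof.
exists (fun _ _ => 0) => r _ /eq_reward <-; split=> [s|].
  by rewrite /= conjugate_rmdp_value smdp_value_ds.
have [pi [Zpi Ypi]] := singleton_optimal r; exists pi; split => //.
exact: dsmdp_optimal_conjugate.
Qed.

End Singleton.

Lemma zero_concave : @concave_on_simplex R M (fun=> 0).
Proof. by move=> p p' t _ _ _; rewrite !mulr0 addr0. Qed.

Lemma zero_argmax w a : (forall b, w b <= w a) ->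
  @reg_argmax R M (fun=> 0) w (fun b => (b == a)%:R).
Proof.
move=> wa; split; first exact: simplex_point.
by move=> p sp; rewrite !addr0 point_mean; exact: simplex_mean_le.
Qed.

Lemma zero_argmax_neq0 w : @reg_argmax R M (fun=> 0) w !=set0.
Proof.
have /card_gt0P[a0 _] := action_gt0 M.
exists (fun b => (b == [arg max_(b > a0) w b]%O)%:R); apply: zero_argmax => b.
by case: arg_maxP => // c _; apply.
Qed.

(** The surplus of this model is max_a w_a, which is not differentiable at ties. *)
Definition zero_rmdp : rmdp M :=
  RMDP (fun _ : S => zero_concave) (fun _ : S => zero_argmax_neq0).

Lemma zero_support w a : (forall b, w b <= w a) ->
  support_fun (reg_controls (M := M) (fun=> 0)) w = w a.
Proof.
move=> wa; rewrite (support_reg_controls zero_argmax_neq0 (zero_argmax wa)).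
by rewrite /payoff/= addr0 point_mean.
Qed.

(** Raising the utility of a by 1 raises the maximum by at most 1, and by 1 exactly
only where a was optimal before. Since the mean rises by 1, this happens almost
surely. *)
Lemma kink_argmax (d : probability noise R) (al : A -> R) a :
  integrable_noise d ->
  expected_max (fun b => - al b) d = 0%E ->
  expected_max (fun b => (b == a)%:R - al b) d = 1%E ->
  d [set e | noisy_argmax (fun b => - al b) e a] = 1%E.
Proof.
move=> id d0 d1.
set w0 := fun b => - al b; set w1 := fun b => (b == a)%:R - al b.
have [psi0 [mpsi0 max0]] := argmax_rule w0.
have [psi1 [mpsi1 max1]] := argmax_rule w1.
pose f0 e := w0 (psi0 e) + noise_at e (psi0 e).
pose f1 e := w1 (psi1 e) + noise_at e (psi1 e).
have i0 : d.-integrable setT (EFin \o f0) by exact: integrable_utility_rule.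
have i1 : d.-integrable setT (EFin \o f1) by exact: integrable_utility_rule.
pose g e := 1 + f0 e - f1 e.
have i2 : d.-integrable setT (EFin \o (fun e => 1 + f0 e)).
  have := integrableD measurableT (finite_measure_integrable_cst d 1 measurableT) i0.
  by apply: eq_integrable.
have ig : d.-integrable setT (EFin \o g).
  by have := integrableB measurableT i2 i1; apply: eq_integrable.
have g0 e : 0 <= g e.
  rewrite /g subr_ge0 /f1; apply: (le_trans _ (lerD (lexx 1) (max0 e (psi1 e)))).
  rewrite /w1 /w0 !addrA lerD2r lerD2r.
  by case: (_ == _); rewrite ?lexx ?ler01.
have Ig : (\int[d]_e `|(g e)%:E| = 0)%E.
  under eq_integral do rewrite gee0_abs ?lee_fin//.
  rewrite -[LHS]fineK ?integrable_fin_num//; congr EFin.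
  rewrite -[LHS]/(\int[d]_e g e) RintegralB// RintegralD//; last first.
    exact: finite_measure_integrable_cst.
  rewrite Rintegral_cst// [X in fine X](probability_setT d) /=.
  move: d0 d1; rewrite (expected_max_rule id mpsi0 max0).
  rewrite (expected_max_rule id mpsi1 max1) -!Rintegral_utility//.
  by rewrite -/f0 -/f1 => -[->] -[->]; rewrite addr0 mulr1 subrr.
have mg : measurable_fun setT (EFin \o g) by exact: measurable_int ig.
have [N [mN dN gN]] := (ae_eq_integral_abs d measurableT mg).1 Ig.
apply/eqP; rewrite eq_le probability_le1/=; last exact: measurable_noisy_argmax.
have <- : d (~` N) = 1%E by rewrite [LHS]probability_setC// dN sube0.
apply: le_measure; rewrite ?inE//; first exact: measurableC.
  exact: measurable_noisy_argmax.
move=> e /= Ne; have ge : g e = 0.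
  by apply: contrapT => ge; apply: Ne; apply: gN => /= /(_ Logic.I)[].
have f1e : f1 e = 1 + f0 e by apply/esym/eqP; rewrite -subr_eq0 -/(g e) ge.
have p1a : psi1 e = a.
  apply/eqP/negPn/negP => /negbTE ne; move: f1e.
  rewrite /f1 /w1 ne sub0r; have := max0 e (psi1 e); rewrite -/(f0 e) /w0; lra.
move=> b; apply: (le_trans (max0 e b)); rewrite -/(f0 e).
by move: f1e; rewrite /f1 /w1 p1a eqxx /w0 /=; lra.
Qed.

(** By [kink_argmax] every action would be optimal with probability 1 at -al, but
the choice probabilities of an absolutely continuous noise sum to 1. *)
Lemma zero_rmdp_not_smdp (Z : smdp M) (al : S -> A -> R) : (1 < #|A|)%N ->
  ~ (forall r r', (forall s a, r s a - r' s a = al s a) ->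
       forall s, rmdp_value zero_rmdp r s = smdp_value Z r' s).
Proof.
move=> A1 VE; have /card_gt0P[s _] := state_gt0 M.
pose d := noise_law Z s.
have fC s' : feasible (reg_controls (reg zero_rmdp s')).
  exact: (reg_controls_feasible zero_argmax_neq0).
have id : integrable_noise d by exact: law_integrable.
have cd : continuous_noise d by exact: law_continuous.
have E w a : (forall b, w b <= w a) ->
    expected_max (fun b => w b - al s b) d = (w a)%:E.
  move=> wa; have <- : surplus [set d] (fun b => w b - al s b) =
      expected_max (fun b => w b - al s b) d.
    by rewrite /surplus image_set1 ereal_sup1.
  rewrite (surplus_support (@singleton_integrable Z s) (singleton_feasible Z s)).
  rewrite -(control_value_inj fC (singleton_feasible Z) (alpha := al)).
    by congr EFin; exact: zero_support.
  move=> r r' rr' s'; rewrite -rmdp_value_control (VE r r' rr').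
  by rewrite smdp_value_ds ds_value_control//; exact: singleton_integrable.
have all1 a : d [set e | noisy_argmax (fun b => - al s b) e a] = 1%E.
  apply: kink_argmax => //.
    apply: etrans (E (fun=> 0) a (fun=> lexx _)).
    by congr expected_max; apply/funext => b; rewrite sub0r.
  rewrite (E (fun b => (b == a)%:R) a) ?eqxx// => b.
  by case: (b == a); rewrite ?lexx ?ler01.
have [psi [mpsi psimax]] := argmax_rule (fun b => - al s b).
have [_ p1] := noise_control_simplex d mpsi.
have pE a : (noise_control d psi).1 a = 1.
  by have := all1 a; rewrite (choice_probability a cd mpsi psimax) => -[].
move: p1; under eq_bigr do rewrite pE.
rewrite sumr_const => /eqP; rewrite -[X in _ == X]/(1%:R) eqr_nat => /eqP A1'.
by rewrite A1' in A1.
Qed.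

End Frameworks.

Theorem theorem2 (R : realType) (M : mdp R) :
  framework_equiv (RMDP_framework M) (DSMDP_framework M) /\
  ((3 <= #|action M|)%N ->
     strictly_subsumes (RMDP_framework M) (SMDP_framework M) /\
     strictly_subsumes (DSMDP_framework M) (SMDP_framework M)).
Proof.
split.
  split => [_ [X _ <-]|_ [Y _ <-]].
    by have [Y XY] := rmdp_to_dsmdp X; exists (dsmdp_model Y) => //; exists Y.
  exists (rmdp_model (conjugate_rmdp Y)); first by exists (conjugate_rmdp Y).
  exact: dsmdp_to_rmdp.
move=> A3; have A1 : (1 < #|action M|)%N by exact: leq_trans A3.
split; split.
- move=> _ [Z _ <-]; exists (rmdp_model (conjugate_rmdp (singleton_dsmdp Z))).
    by exists (conjugate_rmdp (singleton_dsmdp Z)).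
  exact: smdp_to_rmdp.
- exists (rmdp_model zero_rmdp); first by exists zero_rmdp.
  move=> [_ [Z _ <-] [al XZ]]; apply: (@zero_rmdp_not_smdp R M Z al A1) => r r' rr' s.
  by have [VE _] := XZ r r' rr'; exact: VE.
- move=> _ [Z _ <-]; exists (dsmdp_model (singleton_dsmdp Z)).
    by exists (singleton_dsmdp Z).
  exact: smdp_to_dsmdp.
- have [Y [al XY]] := rmdp_to_dsmdp (@zero_rmdp R M).
  exists (dsmdp_model Y); first by exists Y.
  move=> [_ [Z _ <-] [be YZ]].
  apply: (@zero_rmdp_not_smdp R M Z (fun s a => al s a + be s a) A1) => r r' rr' s.
  pose r1 s a := r s a - al s a.
  have rr1 s' a : r1 s' a - r' s' a = be s' a.
    by rewrite /r1 addrAC rr' addrAC subrr add0r.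
  have [VXY _] := XY r r1 (fun s a => subKr _ _).
  have [VYZ _] := YZ r1 r' rr1.
  exact: etrans (VXY s) (VYZ s).
Qed.
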